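(* (1) The map $\Phi$ is a $\ast$-superalgebra homomorphism from $(\mathrm{U}(gl_d\times gl_{m+p|n+q}),\sigma)$ to the oscillator superalgebra $(\mathbb{D}[\mathbf{x},\mathbf{y},\boldsymbol\eta,\boldsymbol\zeta],\omega)$. (2) $\mathbb{C}[\mathbf{x},\mathbf{y},\boldsymbol\eta,\boldsymbol\zeta]$ is a unitarizable $(\mathrm{U}(gl_d\times gl_{m+p|n+q}),\sigma)$-module with respect to the Hermitian form $\langle\,\cdot\,|\,\cdot\,\rangle$.
   Context: Ground field $\mathbb{C}$; $d\ge 1$, $m,n,p,q\ge 0$ integers. **$\ast$-superalgebras.** A $\ast$-superalgebra is an associative superalgebra $A$ with an anti-linear anti-involution $\omega:A\to A$, where $\omega(ab)=\omega(b)\omega(a)$ with no sign factors. A $\ast$-superalgebra homomorphism $f:(A,\omega)\to(A',\omega')$ is a superalgebra homomorphism with $f\circ\omega=\omega'\circ f$. A Hermitian form $\langle\cdot|\cdot\rangle$ on a $\mathbb{Z}_2$-graded $A$-module $V$ is contravariant if $\langle av|v'\rangle=\langle v|\omega(a)v'\rangle$ for all $a\in A$, $v,v'\in V$. A unitarizable $A$-module is one equipped with a positive definite contravariant Hermitian form. **Oscillator superalgebra.** $\mathbb{C}[\mathbf{x},\mathbf{y},\boldsymbol\eta,\boldsymbol\zeta]$ is the polynomial superalgebra generated by even (commuting) variables $x_i^l$ ($1\le i\le m$), $y_r^l$ ($1\le r\le p$) and odd (anticommuting) variables $\eta_j^l$ ($1\le j\le n$), $\zeta_s^l$ ($1\le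 s\le q$), $1\le l\le d$. $\mathbb{D}[\mathbf{x},\mathbf{y},\boldsymbol\eta,\boldsymbol\zeta]\subset\mathrm{End}(\mathbb{C}[\mathbf{x},\mathbf{y},\boldsymbol\eta,\boldsymbol\zeta])$ is generated by (multiplication by) these variables and their derivatives. Its $\ast$-structure $\omega$ interchanges each variable with its derivative: $x_i^l\leftrightarrow\partial/\partial x_i^l$, $\eta_j^l\leftrightarrow\partial/\partial\eta_j^l$, $y_r^l\leftrightarrow\partial/\partial y_r^l$, $\zeta_s^l\leftrightarrow\partial/\partial\zeta_s^l$. The form $\langle\cdot|\cdot\rangle$ is the unique Hermitian form on $\mathbb{C}[\mathbf{x},\mathbf{y},\boldsymbol\eta,\boldsymbol\zeta]$ contravariant with respect to $(\mathbb{D}[\mathbf{x},\mathbf{y},\boldsymbol\eta,\boldsymbol\zeta],\omega)$ with $\langle 1|1\rangle=1$. **Algebras.** $gl_d$ has elementary matrices $e_{ij}$. $gl_{m+p|n+q}$ is the Lie superalgebra of endomorphisms of the superspace with basis $v_A$, $A\in\{1,\dots,m+n+p+q\}$, where $v_A$ is even for $1\le A\le p$ and for $p+q+1\le A\le p+q+m$, and odd otherwise; $E^A_Cv_D=\delta_{CD}v_A$. **The map $\Phi$.** $\Phi:\mathrm{U}(gl_d\times gl_{m+p|n+q})\to\mathbb{D}[\mathbf{x},\mathbf{y},\boldsymbol\eta,\boldsymbol\zeta]$ is the associative superalgebra homomorphism determined by (products are compositions of operators; sums over $l=1,\dots,d$ unless indicated; $i,i'\le m$, $j,j'\le n$, $r,r'\le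 p$, $s,s'\le q$) $$\Phi(e_{ab})=\sum_{k=1}^m x_k^a\tfrac{\partial}{\partial x_k^b}+\sum_{k=1}^n\eta_k^a\tfrac{\partial}{\partial\eta_k^b}-\sum_{k=1}^p y_k^b\tfrac{\partial}{\partial y_k^a}-\sum_{k=1}^q\zeta_k^b\tfrac{\partial}{\partial\zeta_k^a},\quad 1\le a,b\le d,$$ $$\Phi(E^r_{r'})=-\sum_l\tfrac{\partial}{\partial y_r^l}y_{r'}^l,\quad \Phi(E^{p+s}_{p+s'})=\sum_l\tfrac{\partial}{\partial\zeta_s^l}\zeta_{s'}^l,\quad \Phi(E^{p+s}_r)=-\sum_l\tfrac{\partial}{\partial\zeta_s^l}y_r^l,\quad \Phi(E^r_{p+s})=\sum_l\tfrac{\partial}{\partial y_r^l}\zeta_s^l,$$ $$\Phi(E^{p+q+i}_{p+q+i'})=\sum_l x_i^l\tfrac{\partial}{\partial x_{i'}^l},\quad \Phi(E^{m+p+q+j}_{m+p+q+j'})=\sum_l\eta_j^l\tfrac{\partial}{\partial\eta_{j'}^l},$$ $$\Phi(E^{p+q+i}_{m+p+q+j})=\sum_l x_i^l\tfrac{\partial}{\partial\eta_j^l},\quad \Phi(E^{m+p+q+j}_{p+q+i})=\sum_l\eta_j^l\tfrac{\partial}{\partial x_i^l},$$ $$\Phi(E^r_{p+q+i})=\sum_l\tfrac{\partial}{\partial y_r^l}\tfrac{\partial}{\partial x_i^l},\quad \Phi(E^r_{m+p+q+j})=\sum_l\tfrac{\partial}{\partial y_r^l}\tfrac{\partial}{\partial\eta_j^l},\quad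 \Phi(E^{p+s}_{p+q+i})=\sum_l\tfrac{\partial}{\partial\zeta_s^l}\tfrac{\partial}{\partial x_i^l},\quad \Phi(E^{p+s}_{m+p+q+j})=\sum_l\tfrac{\partial}{\partial\zeta_s^l}\tfrac{\partial}{\partial\eta_j^l},$$ $$\Phi(E^{p+q+i}_r)=-\sum_l x_i^ly_r^l,\quad \Phi(E^{p+q+i}_{p+s})=\sum_l x_i^l\zeta_s^l,\quad \Phi(E^{m+p+q+j}_r)=-\sum_l\eta_j^ly_r^l,\quad \Phi(E^{m+p+q+j}_{p+s})=\sum_l\eta_j^l\zeta_s^l.$$ **The $\ast$-structure $\sigma$.** $\sigma$ is the anti-linear anti-involution of $\mathrm{U}(gl_d\times gl_{m+p|n+q})$ given, for $1\le a,b\le p+q$, $p+q+1\le r,s\le p+q+m+n$, $1\le i,j\le d$, by $$E^a_b\mapsto(-1)^{[a]+[b]}E^b_a,\quad E^r_s\mapsto E^s_r,\quad E^a_s\mapsto-(-1)^{[a]}E^s_a,\quad E^r_b\mapsto-(-1)^{[b]}E^b_r,\quad e_{ij}\mapsto e_{ji},$$ where $[a]=0$ for $1\le a\le p$ and $[a]=1$ for $p+1\le a\le p+q$. *)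

(* Defs.v *)
From HB Require Import structures.
From mathcomp Require Import all_boot all_order all_algebra generic_quotient.
From mathcomp Require Import boolp reals.
From mathcomp Require Export complex.
From mathcomp Require Import mpoly.

Set Implicit Arguments.
Unset Strict Implicit.
Unset Printing Implicit Defensive.

Import GRing.Theory Num.Theory.
Local Open Scope ring_scope.
Local Open Scope quotient_scope.

(* Z_2-gradings are families of predicates indexed by the parity b : bool
   (false = even, true = odd); parities add by (+). *)

Section Super.
Variable C : fieldType.

Definition grading (V : lmodType C) (gr : bool -> V -> Prop) : Prop :=
  [/\ forall b, gr b 0,
      forall b (c : C) u v, gr b u -> gr b v -> gr b (c *: u + v),
      forall v, exists v0 v1, [/\ gr false v0, gr true v1 & v = v0 + v1]
    & forall v, gr false v -> gr true v -> v = 0].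

Definition superalgebra (A : algType C) (gr : bool -> A -> Prop) : Prop :=
  [/\ grading gr, gr false 1
    & forall b c x y, gr b x -> gr c y -> gr (b (+) c) (x * y)].

Definition superalgebra_hom (A B : algType C) (grA : bool -> A -> Prop)
    (grB : bool -> B -> Prop) (f : A -> B) : Prop :=
  [/\ linear f, monoid_morphism f & forall b x, grA b x -> grB b (f x)].

Definition supermodule (A : algType C) (grA : bool -> A -> Prop)
    (V : lmodType C) (grV : bool -> V -> Prop) (act : A -> V -> V) : Prop :=
  [/\ superalgebra grA, grading grV,
      (forall a, linear (act a)) /\ (forall v, linear (act ^~ v)),
      (forall v, act 1 v = v) /\
      (forall a b v, act (a * b) v = act a (act b v))
    & forall b c a v, grA b a -> grV c v -> grV (b (+) c) (act a v)].

End Super.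

Section Star.
Variable C : numClosedFieldType.

Definition antilinear (U V : lmodType C) (f : U -> V) : Prop :=
  forall (c : C) u v, f (c *: u + v) = c^* *: f u + f v.

Definition anti_involution (A : algType C) (w : A -> A) : Prop :=
  [/\ antilinear w, forall a b, w (a * b) = w b * w a & involutive w].

Definition star_superalgebra (A : algType C) (gr : bool -> A -> Prop)
    (w : A -> A) : Prop := superalgebra gr /\ anti_involution w.

Definition star_superalgebra_hom (A B : algType C)
    (grA : bool -> A -> Prop) (wA : A -> A)
    (grB : bool -> B -> Prop) (wB : B -> B) (f : A -> B) : Prop :=
  [/\ star_superalgebra grA wA, star_superalgebra grB wB,
      superalgebra_hom grA grB f & forall a, f (wA a) = wB (f a)].

(* Linear in the first argument, conjugate-linear in the second one. *)
Definition hermitian_form (V : lmodType C) := {hermitian V for false & Num.conj}.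

Definition contravariant (A : algType C) (w : A -> A) (V : lmodType C)
    (act : A -> V -> V) (form : hermitian_form V) : Prop :=
  forall a v v', form (act a v) v' = form v (act (w a) v').

Definition unitarizable_module (A : algType C) (grA : bool -> A -> Prop)
    (w : A -> A) (V : lmodType C) (grV : bool -> V -> Prop)
    (act : A -> V -> V) (form : hermitian_form V) : Prop :=
  [/\ star_superalgebra grA w, supermodule grA grV act,
      contravariant w act form & forall v, v != 0 -> 0 < form v v].

End Star.

(* The endomorphism algebra of a possibly infinite-dimensional space; algebras
   V are nontrivial, so that 1 != 0 in End(V). *)

Section Endomorphisms.
Variables (C : fieldType) (V : lalgType C).

Record lendo := Lendo { lendo_fun :> V -> V; lendo_linear : linear lendo_fun }.

HB.instance Definition _ := gen_eqMixin lendo.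
HB.instance Definition _ := gen_choiceMixin lendo.

HB.instance Definition _ (f : lendo) :=
  GRing.isLinear.Build C V V *:%R (lendo_fun f) (@lendo_linear f).

Lemma lendoP (f g : lendo) : f =1 g -> f = g.
Proof.
case: f g => [f fP] [g gP] /= /funext efg; case: _ / efg gP => gP.
by congr Lendo; apply: Prop_irrelevance.
Qed.

Fact lendo0_subproof : linear (fun _ : V => 0 : V).
Proof. by move=> c u v; rewrite scaler0 addr0. Qed.
Fact lendoD_subproof (f g : lendo) : linear (fun v => f v + g v).
Proof. by move=> c u v; rewrite !linearP scalerDr addrACA. Qed.
Fact lendoN_subproof (f : lendo) : linear (fun v => - f v).
Proof. by move=> c u v; rewrite linearP opprD scalerN. Qed.
Fact lendoZ_subproof (a : C) (f : lendo) : linear (fun v => a *: f v).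
Proof. by move=> c u v; rewrite linearP scalerDr !scalerA mulrC. Qed.
Fact lendo1_subproof : linear (fun v : V => v).
Proof. by []. Qed.
Fact lendoM_subproof (f g : lendo) : linear (fun v => f (g v)).
Proof. by move=> c u v; rewrite !linearP. Qed.

Definition lendo0 := Lendo lendo0_subproof.
Definition lendoD f g := Lendo (lendoD_subproof f g).
Definition lendoN f := Lendo (lendoN_subproof f).
Definition lendoZ a f := Lendo (lendoZ_subproof a f).
Definition lendo1 := Lendo lendo1_subproof.
Definition lendoM f g := Lendo (lendoM_subproof f g).

Fact lendoDA : associative lendoD.
Proof. by move=> f g h; apply: lendoP => v /=; rewrite addrA. Qed.
Fact lendoDC : commutative lendoD.
Proof. by move=> f g; apply: lendoP => v /=; rewrite addrC. Qed.
Fact lendo0D : left_id lendo0 lendoD.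
Proof. by move=> f; apply: lendoP => v /=; rewrite add0r. Qed.
Fact lendoND : left_inverse lendo0 lendoN lendoD.
Proof. by move=> f; apply: lendoP => v /=; rewrite addNr. Qed.

HB.instance Definition _ :=
  GRing.isZmodule.Build lendo lendoDA lendoDC lendo0D lendoND.

Fact lendoMA : associative lendoM.
Proof. by move=> f g h; apply: lendoP. Qed.
Fact lendo1M : left_id lendo1 lendoM.
Proof. by move=> f; apply: lendoP. Qed.
Fact lendoM1 : right_id lendo1 lendoM.
Proof. by move=> f; apply: lendoP. Qed.
Fact lendoMDl : left_distributive lendoM +%R.
Proof. by move=> f g h; apply: lendoP. Qed.
Fact lendoMDr : right_distributive lendoM +%R.
Proof. by move=> f g h; apply: lendoP => v /=; rewrite linearD. Qed.
Fact lendo1_neq0 : lendo1 != 0.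
Proof.
apply/eqP => /(congr1 (fun f : lendo => f 1)) /= /eqP.
by rewrite oner_eq0.
Qed.

HB.instance Definition _ := GRing.Zmodule_isNzRing.Build lendo
  lendoMA lendo1M lendoM1 lendoMDl lendoMDr lendo1_neq0.

Fact lendoZA a b (f : lendo) : lendoZ a (lendoZ b f) = lendoZ (a * b) f.
Proof. by apply: lendoP => v /=; rewrite scalerA. Qed.
Fact lendo1Z : left_id 1 lendoZ.
Proof. by move=> f; apply: lendoP => v /=; rewrite scale1r. Qed.
Fact lendoZDr : right_distributive lendoZ +%R.
Proof. by move=> a f g; apply: lendoP => v /=; rewrite scalerDr. Qed.
Fact lendoZDl (f : lendo) : {morph lendoZ^~ f : a b / a + b}.
Proof. by move=> a b; apply: lendoP => v /=; rewrite scalerDl. Qed.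

HB.instance Definition _ :=
  GRing.Zmodule_isLmodule.Build C lendo lendoZA lendo1Z lendoZDr lendoZDl.

Fact lendo_scalerAl (a : C) (f g : lendo) : a *: (f * g) = (a *: f) * g.
Proof. by apply: lendoP. Qed.
HB.instance Definition _ :=
  GRing.Lmodule_isLalgebra.Build C lendo lendo_scalerAl.
Fact lendo_scalerAr (a : C) (f g : lendo) : a *: (f * g) = f * (a *: g).
Proof. by apply: lendoP => v /=; rewrite linearZ. Qed.
HB.instance Definition _ :=
  GRing.Lalgebra_isAlgebra.Build C lendo lendo_scalerAr.

End Endomorphisms.

(* The polynomial superalgebra on even variables indexed by E and odd variables
   indexed by O: the element f stands for \sum_(S : {set O}) f S * eta_S, where
   eta_S is the product of the odd variables in S taken in the order of the
   enumeration of O. *)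

Section SuperPoly.
Variables (C : fieldType) (E O : finType).

Definition superpoly : Type := {ffun {set O} -> {mpoly C[#|E|]}}.

HB.instance Definition _ := GRing.Lmodule.on superpoly.

Implicit Types (f g h : superpoly) (A B D S : {set O}).

(* eta_A * eta_B = (-1) ^+ inversions A B * eta_(A :|: B) for disjoint A, B *)
Definition inversions A B : nat :=
  #|[set ab in setX A B | (enum_rank ab.2 < enum_rank ab.1)%N]|.

Definition superpoly_mul f g : superpoly :=
  [ffun S : {set O} => \sum_(A : {set O} | A \subset S)
     (-1) ^+ inversions A (S :\: A) * f A * g (S :\: A)].

Definition superpoly_one : superpoly := [ffun S : {set O} => (S == set0)%:R].

Lemma inversions0l A : inversions set0 A = 0%N.
Proof. by apply/eqP; rewrite cards_eq0; apply/eqP/setP=> ab; rewrite !inE. Qed.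

Lemma inversions0r A : inversions A set0 = 0%N.
Proof.
by apply/eqP; rewrite cards_eq0; apply/eqP/setP=> ab; rewrite !inE andbF.
Qed.

Lemma inversionsUl A B D : [disjoint A & B] ->
  inversions (A :|: B) D = (inversions A D + inversions B D)%N.
Proof.
move=> dAB; rewrite /inversions -cardsUI.
rewrite [X in (_ + X)%N](_ : _ = 0%N) ?addn0; last first.
  apply/eqP; rewrite cards_eq0; apply/eqP/setP=> -[a b]; rewrite !inE /=; apply/negP => /andP[].
  by case/andP=> /andP[aA _] _ /andP[/andP[aB _] _]; rewrite (disjointFr dAB aA) in aB.
by apply: eq_card => -[a b]; rewrite !inE /= -andb_orl -andb_orl.
Qed.

Lemma inversionsUr A B D : [disjoint B & D] ->
  inversions A (B :|: D) = (inversions A B + inversions A D)%N.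
Proof.
move=> dBD; rewrite /inversions -cardsUI.
rewrite [X in (_ + X)%N](_ : _ = 0%N) ?addn0; last first.
  apply/eqP; rewrite cards_eq0; apply/eqP/setP=> -[a b]; rewrite !inE /=; apply/negP => /andP[].
  by case/andP=> /andP[_ bB] _ /andP[/andP[_ bD] _]; rewrite (disjointFr dBD bB) in bD.
by apply: eq_card => -[a b]; rewrite !inE /= -andb_orl -andb_orr.
Qed.

Fact superpoly_mulA : associative superpoly_mul.
Proof.
move=> f g h; apply/ffunP=> S; rewrite !ffunE.
under eq_bigr => A _ do rewrite ffunE mulr_sumr.
under [RHS]eq_bigr => T _ do rewrite ffunE mulr_sumr mulr_suml.
rewrite [RHS](exchange_big_dep (fun A : {set O} => A \subset S)) /=; last first.
  by move=> T A TS AT; apply: subset_trans TS.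
apply: eq_bigr => A AS.
rewrite [RHS](reindex_onto (fun B => A :|: B) (fun T => T :\: A)) /=; last first.
  by move=> T /andP[_ AT]; rewrite setDE setUIr setUCr setIT; apply/setUidPr.
apply: eq_big => [B | B].
  rewrite subUset AS subsetUl /= andbT subsetD.
  congr (_ && _); rewrite setDUl setDv set0U; apply/idP/eqP.
    by move/setDidPl.
  by move/setDidPl.
rewrite subsetD => /andP[BS dBA].
have eB : (A :|: B) :\: A = B by rewrite setDUl setDv set0U; apply/setDidPl.
have eD : S :\: (A :|: B) = (S :\: A) :\: B by rewrite setDDl.
set D := (S :\: A) :\: B in eD *.
have eBD : S :\: A = B :|: D.
  by apply/setP=> x; rewrite /D !inE; case xB: (x \in B); rewrite //= ?orbF;
     rewrite (subsetP BS _ xB) andbT (disjointFr dBA xB).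
have dBD : [disjoint B & D] by rewrite disjoints_subset; apply/subsetP=> x xB;
  rewrite /D !inE xB.
rewrite eB eD eBD inversionsUr // inversionsUl; last by rewrite disjoint_sym.
rewrite !exprD; have c k (z : {mpoly C[#|E|]}) : z * (-1) ^+ k = (-1) ^+ k * z.
  by rewrite mulrC.
rewrite !mulrA; congr (_ * _ * _).
by rewrite !(mulrAC _ (f A)); congr (_ * _); rewrite [RHS]mulrC mulrA.
Qed.

Fact superpoly_mul1l : left_id superpoly_one superpoly_mul.
Proof.
move=> f; apply/ffunP=> S; rewrite ffunE (bigD1 set0) ?sub0set //= big1 => [|A].
  by rewrite ffunE eqxx setD0 inversions0l mul1r mul1r addr0.
by case/andP=> _ /negPf A0; rewrite ffunE A0 mulr0 mul0r.
Qed.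

Fact superpoly_mul1r : right_id superpoly_one superpoly_mul.
Proof.
move=> f; apply/ffunP=> S; rewrite ffunE (bigD1 S) //= big1 => [|A].
  by rewrite setDv ffunE eqxx inversions0r mul1r mulr1 addr0.
case/andP=> AS nAS; rewrite ffunE setD_eq0 (_ : _ \subset _ = false) ?mulr0 //.
by apply: contraNF nAS => SA; rewrite eqEsubset AS.
Qed.

Fact superpoly_mulDl : left_distributive superpoly_mul +%R.
Proof.
move=> f g h; apply/ffunP=> S; rewrite !ffunE -big_split; apply: eq_bigr => A _.
by rewrite ffunE mulrDr mulrDl.
Qed.

Fact superpoly_mulDr : right_distributive superpoly_mul +%R.
Proof.
move=> f g h; apply/ffunP=> S; rewrite !ffunE -big_split; apply: eq_bigr => A _.
by rewrite ffunE mulrDr.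
Qed.

Fact superpoly_one_neq0 : superpoly_one != 0.
Proof.
apply/eqP => /ffunP/(_ set0)/eqP.
by rewrite !ffunE eqxx oner_eq0.
Qed.

HB.instance Definition _ := GRing.Zmodule_isNzRing.Build superpoly
  superpoly_mulA superpoly_mul1l superpoly_mul1r superpoly_mulDl superpoly_mulDr
  superpoly_one_neq0.

Fact superpoly_scalerAl (c : C) f g : c *: (f * g) = (c *: f) * g.
Proof.
apply/ffunP=> S; rewrite !ffunE scaler_sumr; apply: eq_bigr => A _.
by rewrite ffunE -scalerAr -scalerAl.
Qed.
HB.instance Definition _ :=
  GRing.Lmodule_isLalgebra.Build C superpoly superpoly_scalerAl.
Fact superpoly_scalerAr (c : C) f g : c *: (f * g) = f * (c *: g).
Proof.
apply/ffunP=> S; rewrite !ffunE scaler_sumr; apply: eq_bigr => A _.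
by rewrite ffunE -scalerAr.
Qed.
HB.instance Definition _ :=
  GRing.Lalgebra_isAlgebra.Build C superpoly superpoly_scalerAr.

Definition superpoly_parity (b : bool) f : Prop :=
  forall S, f S != 0 -> odd #|S| = b.

Definition supervar (v : E + O) : superpoly :=
  match v with
  | inl i => [ffun S : {set O} => if S == set0 then 'X_(enum_rank i) else 0]
  | inr j => [ffun S : {set O} => (S == [set j])%:R]
  end.

(* The partial derivative for an even variable, the left superderivative for an
   odd one: d/d eta_j kills eta_T if j is not in T, and otherwise moves eta_j to
   the front of eta_T and erases it. *)
Definition superderiv (v : E + O) f : superpoly :=
  match v with
  | inl i => [ffun S : {set O} => mderiv (enum_rank i) (f S)]
  | inr j => [ffun S : {set O} =>
      if j \in S then 0 else (-1) ^+ inversions [set j] S * f (j |: S)]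
  end.

Fact supervar_linear v : linear (fun f => supervar v * f).
Proof. by move=> c f g; rewrite mulrDr scalerAr. Qed.

Fact superderiv_linear v : linear (superderiv v).
Proof.
move=> c f g; case: v => [i | j]; apply/ffunP=> S; rewrite !ffunE.
  by rewrite linearP.
case: ifP => _; first by rewrite scaler0 addr0.
by rewrite mulrDr scalerAr.
Qed.

Definition mulvar v : lendo superpoly := Lendo (supervar_linear v).
Definition dervar v : lendo superpoly := Lendo (superderiv_linear v).

(* The subalgebra D of End(C[x, y, eta, zeta]) *)
Inductive osc_generated : lendo superpoly -> Prop :=
| OscVar v : osc_generated (mulvar v)
| OscDer v : osc_generated (dervar v)
| OscOne : osc_generated 1
| OscLin (c : C) a b :
    osc_generated a -> osc_generated b -> osc_generated (c *: a + b)
| OscMul a b : osc_generated a -> osc_generated b -> osc_generated (a * b).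

Definition osc_pred : {pred lendo superpoly} := fun a => `[<osc_generated a>].

Fact osc_subalg : subalg_closed osc_pred.
Proof.
split; first by apply/asboolP; apply: OscOne.
  by move=> c a b /asboolP ha /asboolP hb; apply/asboolP; apply: OscLin.
by move=> a b /asboolP ha /asboolP hb; apply/asboolP; apply: OscMul.
Qed.

HB.instance Definition _ := GRing.isSubalgClosed.Build C (lendo superpoly)
  osc_pred (GRing.subalg_closed_semi osc_subalg).

Record oscillator :=
  Oscillator { osc_val :> lendo superpoly; osc_valP : osc_val \in osc_pred }.

HB.instance Definition _ := [isSub for osc_val].
HB.instance Definition _ := [Choice of oscillator by <:].
HB.instance Definition _ := [SubChoice_isSubAlgebra of oscillator by <:].

Fact mulvar_osc v : mulvar v \in osc_pred.
Proof. by apply/asboolP; apply: OscVar. Qed.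
Fact dervar_osc v : dervar v \in osc_pred.
Proof. by apply/asboolP; apply: OscDer. Qed.

Definition osc_var v : oscillator := Oscillator (mulvar_osc v).
Definition osc_der v : oscillator := Oscillator (dervar_osc v).

Definition osc_parity (b : bool) (a : oscillator) : Prop :=
  forall c f, superpoly_parity c f -> superpoly_parity (b (+) c) (a f).

End SuperPoly.

(* The universal enveloping superalgebra of a Lie superalgebra L with homogeneous
   components gr b and superbracket br: the associative unital algebra generated
   by the space L subject to x y - (-1)^(|x||y|) y x = [x, y] for homogeneous x
   and y. It is built as a quotient of the formal algebraic expressions in the
   elements of L. *)

Section Enveloping.
Variables (C : fieldType) (L : lmodType C).
Variables (gr : bool -> L -> Prop) (br : L -> L -> L).

Inductive uexpr : Type :=
| UGen of L
| UScal of C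
| UAdd of uexpr & uexpr
| UMul of uexpr & uexpr.

Inductive ueq : uexpr -> uexpr -> Prop :=
| UeqRefl s : ueq s s
| UeqSym s t : ueq s t -> ueq t s
| UeqTrans s t u : ueq s t -> ueq t u -> ueq s u
| UeqAdd s s' t t' : ueq s s' -> ueq t t' -> ueq (UAdd s t) (UAdd s' t')
| UeqMul s s' t t' : ueq s s' -> ueq t t' -> ueq (UMul s t) (UMul s' t')
| UeqAddA s t u : ueq (UAdd s (UAdd t u)) (UAdd (UAdd s t) u)
| UeqAddC s t : ueq (UAdd s t) (UAdd t s)
| UeqAdd0 s : ueq (UAdd (UScal 0) s) s
| UeqAddN s : ueq (UAdd (UMul (UScal (-1)) s) s) (UScal 0)
| UeqMulA s t u : ueq (UMul s (UMul t u)) (UMul (UMul s t) u)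
| UeqMul1 s : ueq (UMul (UScal 1) s) s
| UeqMulDl s t u : ueq (UMul (UAdd s t) u) (UAdd (UMul s u) (UMul t u))
| UeqMulDr s t u : ueq (UMul s (UAdd t u)) (UAdd (UMul s t) (UMul s u))
| UeqScalC a s : ueq (UMul (UScal a) s) (UMul s (UScal a))
| UeqScalD a b : ueq (UScal (a + b)) (UAdd (UScal a) (UScal b))
| UeqScalM a b : ueq (UScal (a * b)) (UMul (UScal a) (UScal b))
| UeqGen a x y : ueq (UGen (a *: x + y)) (UAdd (UMul (UScal a) (UGen x)) (UGen y))
| UeqBracket b c x y : gr b x -> gr c y ->
    ueq (UAdd (UMul (UGen x) (UGen y))
              (UMul (UScal (- (-1) ^+ (b && c))) (UMul (UGen y) (UGen x))))
        (UGen (br x y)).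

HB.instance Definition _ := gen_eqMixin uexpr.
HB.instance Definition _ := gen_choiceMixin uexpr.

Definition ueqb : rel uexpr := fun s t => `[<ueq s t>].

Fact ueqb_equiv : equiv_class_of ueqb.
Proof.
split.
- by move=> s; apply/asboolP/UeqRefl.
- by move=> s t; apply/asboolP/asboolP; apply: UeqSym.
- by move=> t s u /asboolP st /asboolP tu; apply/asboolP; apply: UeqTrans tu.
Qed.
Canonical ueqb_equivRel := EquivRelPack ueqb_equiv.

Definition uea : Type := {eq_quot ueqb}.
HB.instance Definition _ : EqQuotient _ ueqb uea := EqQuotient.on uea.
HB.instance Definition _ := Choice.on uea.

Lemma uea_eq s t : ueq s t -> \pi_uea s = \pi_uea t.
Proof. by move=> st; apply/eqmodP/asboolP. Qed.

Lemma uea_repr s : ueq (repr (\pi_uea s)) s.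
Proof.
have /eqmodP : \pi_uea (repr (\pi_uea s)) = \pi_uea s by rewrite reprK.
by move/asboolP.
Qed.

Definition uea_scal a : uea := \pi_uea (UScal a).
Definition uea_add (x y : uea) : uea := \pi_uea (UAdd (repr x) (repr y)).
Definition uea_mul (x y : uea) : uea := \pi_uea (UMul (repr x) (repr y)).
Definition uea_opp (x : uea) : uea := uea_mul (uea_scal (-1)) x.

Lemma uea_addE s t : uea_add (\pi_uea s) (\pi_uea t) = \pi_uea (UAdd s t).
Proof. by apply: uea_eq; apply: UeqAdd; apply: uea_repr. Qed.
Lemma uea_mulE s t : uea_mul (\pi_uea s) (\pi_uea t) = \pi_uea (UMul s t).
Proof. by apply: uea_eq; apply: UeqMul; apply: uea_repr. Qed.

Lemma uea_ind (P : uea -> Prop) : (forall s, P (\pi_uea s)) -> forall x, P x.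
Proof. by move=> h x; rewrite -[x]reprK. Qed.

Fact uea_addA : associative uea_add.
Proof.
elim/uea_ind=> s; elim/uea_ind=> t; elim/uea_ind=> u.
by rewrite !uea_addE; apply/uea_eq/UeqAddA.
Qed.
Fact uea_addC : commutative uea_add.
Proof.
by elim/uea_ind=> s; elim/uea_ind=> t; rewrite !uea_addE; apply/uea_eq/UeqAddC.
Qed.
Fact uea_add0 : left_id (uea_scal 0) uea_add.
Proof. by elim/uea_ind=> s; rewrite uea_addE; apply/uea_eq/UeqAdd0. Qed.
Fact uea_addN : left_inverse (uea_scal 0) uea_opp uea_add.
Proof. by elim/uea_ind=> s; rewrite /uea_opp uea_mulE uea_addE; apply/uea_eq/UeqAddN. Qed.

HB.instance Definition _ :=
  GRing.isZmodule.Build uea uea_addA uea_addC uea_add0 uea_addN.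

Fact uea_mulA : associative uea_mul.
Proof.
elim/uea_ind=> s; elim/uea_ind=> t; elim/uea_ind=> u.
by rewrite !uea_mulE; apply/uea_eq/UeqMulA.
Qed.
Fact uea_mul1l : left_id (uea_scal 1) uea_mul.
Proof. by elim/uea_ind=> s; rewrite uea_mulE; apply/uea_eq/UeqMul1. Qed.
Fact uea_scalC a x : uea_mul (uea_scal a) x = uea_mul x (uea_scal a).
Proof.
by elim/uea_ind: x => s; rewrite !uea_mulE; apply/uea_eq/UeqScalC.
Qed.
Fact uea_mul1r : right_id (uea_scal 1) uea_mul.
Proof. by move=> x; rewrite -uea_scalC uea_mul1l. Qed.
Fact uea_mulDl : left_distributive uea_mul +%R.
Proof.
elim/uea_ind=> s; elim/uea_ind=> t; elim/uea_ind=> u.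
change (uea_mul (uea_add (\pi_uea s) (\pi_uea t)) (\pi_uea u) =
  uea_add (uea_mul (\pi_uea s) (\pi_uea u)) (uea_mul (\pi_uea t) (\pi_uea u))).
by rewrite uea_addE !uea_mulE uea_addE; apply/uea_eq/UeqMulDl.
Qed.
Fact uea_mulDr : right_distributive uea_mul +%R.
Proof.
elim/uea_ind=> s; elim/uea_ind=> t; elim/uea_ind=> u.
change (uea_mul (\pi_uea s) (uea_add (\pi_uea t) (\pi_uea u)) =
  uea_add (uea_mul (\pi_uea s) (\pi_uea t)) (uea_mul (\pi_uea s) (\pi_uea u))).
by rewrite uea_addE !uea_mulE uea_addE; apply/uea_eq/UeqMulDr.
Qed.

Fixpoint uexpr_aug (s : uexpr) : C :=
  match s with
  | UGen _ => 0
  | UScal a => a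
  | UAdd s t => uexpr_aug s + uexpr_aug t
  | UMul s t => uexpr_aug s * uexpr_aug t
  end.

Lemma uexpr_augP s t : ueq s t -> uexpr_aug s = uexpr_aug t.
Proof.
elim=> //=.
- by move=> u v w _ -> _ ->.
- by move=> u u' v v' _ -> _ ->.
- by move=> u u' v v' _ -> _ ->.
- by move=> *; rewrite addrA.
- by move=> *; rewrite addrC.
- by move=> *; rewrite add0r.
- by move=> *; rewrite mulN1r addNr.
- by move=> *; rewrite mulrA.
- by move=> *; rewrite mul1r.
- by move=> *; rewrite mulrDl.
- by move=> *; rewrite mulrDr.
- by move=> *; rewrite mulrC.
- by move=> *; rewrite mulr0 addr0.
- by move=> *; rewrite !mulr0 addr0.
Qed.

Fact uea_one_neq0 : uea_scal 1 != 0.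
Proof.
apply/eqP=> /eqmodP /asboolP /uexpr_augP /= /eqP.
by rewrite oner_eq0.
Qed.

HB.instance Definition _ := GRing.Zmodule_isNzRing.Build uea
  uea_mulA uea_mul1l uea_mul1r uea_mulDl uea_mulDr uea_one_neq0.

Definition uea_scale a (x : uea) : uea := uea_scal a * x.

Lemma uea_scalM a b : uea_scal (a * b) = uea_scal a * uea_scal b.
Proof. by rewrite [RHS]uea_mulE; apply/uea_eq/UeqScalM. Qed.

Fact uea_scaleA a b x : uea_scale a (uea_scale b x) = uea_scale (a * b) x.
Proof. by rewrite /uea_scale uea_scalM mulrA. Qed.
Fact uea_scale1 : left_id 1 uea_scale.
Proof. exact: mul1r. Qed.
Fact uea_scaleDr : right_distributive uea_scale +%R.
Proof. by move=> a x y; apply: mulrDr. Qed.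
Fact uea_scaleDl x : {morph uea_scale^~ x : a b / a + b}.
Proof.
move=> a b; rewrite /uea_scale -mulrDl; congr (_ * _).
by rewrite [RHS]uea_addE; apply/uea_eq/UeqScalD.
Qed.

HB.instance Definition _ :=
  GRing.Zmodule_isLmodule.Build C uea uea_scaleA uea_scale1 uea_scaleDr uea_scaleDl.

Fact uea_scalerAl (a : C) (x y : uea) : a *: (x * y) = (a *: x) * y.
Proof. exact: mulrA. Qed.
HB.instance Definition _ := GRing.Lmodule_isLalgebra.Build C uea uea_scalerAl.
Fact uea_scalerAr (a : C) (x y : uea) : a *: (x * y) = x * (a *: y).
Proof.
change (uea_scal a * (x * y) = x * (uea_scal a * y)).
by rewrite mulrA [uea_scal a * x]uea_scalC -mulrA.
Qed.
HB.instance Definition _ := GRing.Lalgebra_isAlgebra.Build C uea uea_scalerAr.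

Definition uea_gen (x : L) : uea := \pi_uea (UGen x).

Inductive uea_parity : bool -> uea -> Prop :=
| UparGen b x : gr b x -> uea_parity b (uea_gen x)
| UparOne : uea_parity false 1
| UparZero b : uea_parity b 0
| UparLin b (c : C) x y :
    uea_parity b x -> uea_parity b y -> uea_parity b (c *: x + y)
| UparMul b c x y :
    uea_parity b x -> uea_parity c y -> uea_parity (b (+) c) (x * y).

End Enveloping.

(* The Lie superalgebra gl_d x gl_(m+p|n+q), with gl_(m+p|n+q) realized as
   matrices acting on column vectors. The index A = 1, ..., p+q+m+n is shifted
   to start from 0. *)

Section GL.
Variables (C : fieldType) (d m n p q : nat).

Local Notation N := ((p + q) + (m + n))%N.

Definition gl_index_odd (A : 'I_N) : bool :=
  (p <= A < p + q)%N || (p + q + m <= A)%N.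

Definition glpart (b : bool) (X : 'M[C]_N) : 'M[C]_N :=
  \matrix_(A, B)
    (if gl_index_odd A (+) gl_index_odd B == b then X A B else 0).

Definition glbracket (X Y : 'M[C]_N) : 'M[C]_N :=
  \sum_(b : bool) \sum_(c : bool)
    (glpart b X *m glpart c Y - (-1) ^+ (b && c) *: (glpart c Y *m glpart b X)).

Definition ggl : Type := ('M[C]_d * 'M[C]_N)%type.

Definition ggl_parity (b : bool) (z : ggl) : Prop :=
  (b -> z.1 = 0) /\ glpart b z.2 = z.2.

Definition ggl_bracket (z w : ggl) : ggl :=
  (z.1 *m w.1 - w.1 *m z.1, glbracket z.2 w.2).

Definition Ugl := uea ggl_parity ggl_bracket.
Definition Ugl_parity : bool -> Ugl -> Prop :=
  @uea_parity C ggl ggl_parity ggl_bracket.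

Definition egl (a b : 'I_d) : Ugl :=
  uea_gen ggl_parity ggl_bracket (delta_mx a b, 0).
Definition Egl (A B : 'I_N) : Ugl :=
  uea_gen ggl_parity ggl_bracket (0, delta_mx A B).

Definition iy (r : 'I_p) : 'I_N := lshift (m + n) (lshift q r).
Definition izeta (s : 'I_q) : 'I_N := lshift (m + n) (rshift p s).
Definition ix (i : 'I_m) : 'I_N := rshift (p + q) (lshift n i).
Definition ieta (j : 'I_n) : 'I_N := rshift (p + q) (rshift m j).

Definition osc_even : finType := (('I_m + 'I_p) * 'I_d)%type.
Definition osc_odd : finType := (('I_n + 'I_q) * 'I_d)%type.

Definition Spoly := superpoly C osc_even osc_odd.
Definition Spoly_parity : bool -> Spoly -> Prop :=
  @superpoly_parity C osc_even osc_odd.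

Definition Osc := oscillator C osc_even osc_odd.
Definition Osc_parity : bool -> Osc -> Prop := @osc_parity C osc_even osc_odd.

Definition Osc_act (a : Osc) (f : Spoly) : Spoly := a f.

Definition xvar i l : Osc := osc_var C (inl (inl i, l)).
Definition yvar r l : Osc := osc_var C (inl (inr r, l)).
Definition etavar j l : Osc := osc_var C (inr (inl j, l)).
Definition zetavar s l : Osc := osc_var C (inr (inr s, l)).
Definition dx i l : Osc := osc_der C (inl (inl i, l)).
Definition dy r l : Osc := osc_der C (inl (inr r, l)).
Definition deta j l : Osc := osc_der C (inr (inl j, l)).
Definition dzeta s l : Osc := osc_der C (inr (inr s, l)).

Record is_Phi (Phi : Ugl -> Osc) : Prop := IsPhi {
  Phi_hom : superalgebra_hom Ugl_parity Osc_parity Phi;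
  Phi_e : forall a b, Phi (egl a b) =
    \sum_k xvar k a * dx k b + \sum_k etavar k a * deta k b
    - \sum_k yvar k b * dy k a - \sum_k zetavar k b * dzeta k a;
  Phi_yy : forall r r',
    Phi (Egl (iy r) (iy r')) = - \sum_l dy r l * yvar r' l;
  Phi_zz : forall s s',
    Phi (Egl (izeta s) (izeta s')) = \sum_l dzeta s l * zetavar s' l;
  Phi_zy : forall s r,
    Phi (Egl (izeta s) (iy r)) = - \sum_l dzeta s l * yvar r l;
  Phi_yz : forall r s,
    Phi (Egl (iy r) (izeta s)) = \sum_l dy r l * zetavar s l;
  Phi_xx : forall i i',
    Phi (Egl (ix i) (ix i')) = \sum_l xvar i l * dx i' l;
  Phi_ee : forall j j',
    Phi (Egl (ieta j) (ieta j')) = \sum_l etavar j l * deta j' l;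
  Phi_xe : forall i j,
    Phi (Egl (ix i) (ieta j)) = \sum_l xvar i l * deta j l;
  Phi_ex : forall j i,
    Phi (Egl (ieta j) (ix i)) = \sum_l etavar j l * dx i l;
  Phi_yx : forall r i,
    Phi (Egl (iy r) (ix i)) = \sum_l dy r l * dx i l;
  Phi_ye : forall r j,
    Phi (Egl (iy r) (ieta j)) = \sum_l dy r l * deta j l;
  Phi_zx : forall s i,
    Phi (Egl (izeta s) (ix i)) = \sum_l dzeta s l * dx i l;
  Phi_ze : forall s j,
    Phi (Egl (izeta s) (ieta j)) = \sum_l dzeta s l * deta j l;
  Phi_xy : forall i r,
    Phi (Egl (ix i) (iy r)) = - \sum_l xvar i l * yvar r l;
  Phi_xz : forall i s,
    Phi (Egl (ix i) (izeta s)) = \sum_l xvar i l * zetavar s l;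
  Phi_ey : forall j r,
    Phi (Egl (ieta j) (iy r)) = - \sum_l etavar j l * yvar r l;
  Phi_ez : forall j s,
    Phi (Egl (ieta j) (izeta s)) = \sum_l etavar j l * zetavar s l
}.

End GL.

Section GLStar.
Variables (C : numClosedFieldType) (d m n p q : nat).

Local Notation U := (Ugl C d m n p q).
Local Notation Osc := (Osc C d m n p q).
Local Notation Spoly := (Spoly C d m n p q).
Local Notation E := (@Egl C d m n p q).
Local Notation e := (@egl C d m n p q).

(* The sign (-1)^[a] of an index a among the first p + q ones *)
Definition sgi (a : 'I_(p + q)) : C := (-1) ^+ (p <= a)%N.

Record is_sigma (sigma : U -> U) : Prop := IsSigma {
  sigma_anti : anti_involution sigma;
  sigma_ll : forall a b : 'I_(p + q),
    sigma (E (lshift (m + n) a) (lshift (m + n) b)) =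
    (sgi a * sgi b) *: E (lshift (m + n) b) (lshift (m + n) a);
  sigma_rr : forall r s : 'I_(m + n),
    sigma (E (rshift (p + q) r) (rshift (p + q) s)) =
    E (rshift (p + q) s) (rshift (p + q) r);
  sigma_lr : forall (a : 'I_(p + q)) (s : 'I_(m + n)),
    sigma (E (lshift (m + n) a) (rshift (p + q) s)) =
    - sgi a *: E (rshift (p + q) s) (lshift (m + n) a);
  sigma_rl : forall (r : 'I_(m + n)) (b : 'I_(p + q)),
    sigma (E (rshift (p + q) r) (lshift (m + n) b)) =
    - sgi b *: E (lshift (m + n) b) (rshift (p + q) r);
  sigma_e : forall i j, sigma (e i j) = e j i
}.

Record is_omega (omega : Osc -> Osc) : Prop := IsOmega {
  omega_anti : anti_involution omega;
  omega_var : forall v, omega (osc_var C v) = osc_der C v;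
  omega_der : forall v, omega (osc_der C v) = osc_var C v
}.

Definition is_osc_form (omega : Osc -> Osc) (form : hermitian_form Spoly) :
    Prop :=
  contravariant omega (@Osc_act C d m n p q) form /\ form 1 1 = 1.

End GLStar.

(* Main.v *)
Require Import Defs.
From HB Require Import structures.
From mathcomp Require Import all_boot all_order all_algebra generic_quotient.
From mathcomp Require Import boolp reals ssrcomplements mpoly ring.

Set Implicit Arguments.
Unset Strict Implicit.
Unset Printing Implicit Defensive.

Import Order.TTheory GRing.Theory Num.Theory.
Local Open Scope quotient_scope.
Local Open Scope ring_scope.

(** Index the variables by J = {1..N} x {1..d} and set P = derivative, Q = - variable
    for y, P = derivative, Q = variable for zeta, and P = variable, Q = derivative for
    x and eta. Then Q_J P_K - (-1)^(|J||K|) P_K Q_J = delta_JK while the P, and likewise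
    the Q, supercommute, so M |-> \sum_(J, K) M_JK P_J Q_K is a homomorphism from gl(J)
    for the superbracket. All the operators Phi(E^A_B) and, up to a multiple of the
    trace, Phi(e_ab) are images of Y (x) 1 and 1 (x) X under this map.
    On monomials the form is the Fischer form <x^a|x^b> = delta_ab a!, with the eta_S
    orthonormal; omega is the adjoint for it, so that omega(P_J) = - eps_J Q_J with
    eps_J = (-1)^[J] for y, zeta and -1 for x, eta. Since sigma is Y |-> D Y^* D with
    D = diag(eps), this gives Phi sigma = omega Phi. *)

(** * The Fischer form *)

(** The operator algebra is a subalgebra of an endomorphism algebra and comes without a
    presentation, so [omega] cannot simply be prescribed on letters and extended. It is obtained
    from the form: by induction along the generation of the subalgebra every element has an adjoint
    that again lies in the subalgebra, and positive definiteness makes this adjoint unique. The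
    rules of an anti-involution and the contravariance of the form follow from that
    characterization. Maps out of the enveloping algebra are evaluations of expressions. The
    delicate point of its grading, that no nonzero element is both even and odd, is settled by
    extending the parity automorphism. The choice of P and Q turns all sixteen families of operators
    on the side of the larger algebra into one sum, so that every superbracket reduces to a single
    computation with four letters instead of a case analysis on blocks. *)

Section Fischer.
Variables (C : numClosedFieldType) (n : nat).
Implicit Types (f g h : {mpoly C[n]}) (m : 'X_{1..n}).

Definition mnm_fact m : nat := \prod_(i < n) (m i)`!.

Lemma mnm_fact_gt0 m : (0 < mnm_fact m)%N.
Proof. by apply: prodn_gt0 => i; apply: fact_gt0. Qed.

Lemma mnm_factS m i : mnm_fact (m + U_(i)) = ((m i).+1 * mnm_fact m)%N.
Proof.
rewrite /mnm_fact (bigD1 i) //= [in RHS](bigD1 i) //= mulnA mnmDE mnm1E eqxx.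
rewrite addn1 factS; congr (_ * _)%N; apply: eq_bigr => j /negPf ji.
by rewrite mnmDE mnm1E eq_sym ji addn0.
Qed.

Definition fischer f g : C :=
  \sum_(m <- msupp f) f@_m * (g@_m)^* * (mnm_fact m)%:R.

(** The support of the first argument varies with it; a common index set of bounded degree makes the
    sums for different arguments comparable. *)
Lemma fischerwE f g k : (msize f <= k)%N ->
  fischer f g = \sum_(m : 'X_{1..n < k}) f@_m * (g@_m)^* * (mnm_fact m)%:R.
Proof.
move=> fk; rewrite /fischer (big_mksub 'X_{1..n < k}) /=; first last.
- by move=> x /msize_mdeg_lt /leq_trans; apply.
- by rewrite msupp_uniq.
by rewrite big_rmcond //= => j /memN_msupp_eq0 ->; rewrite !mul0r.
Qed.

Lemma fischer_linearl g : linear_for *%R (fischer^~ g).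
Proof.
move=> c f h; pose k := maxn (msize (c *: f + h)) (maxn (msize f) (msize h)).
have [k1 k2 k3] : [/\ msize (c *: f + h) <= k, msize f <= k & msize h <= k]%N.
  by rewrite /k !leq_max !leqnn !orbT.
rewrite !(@fischerwE _ _ k) // mulr_sumr -big_split; apply: eq_bigr => m _ /=.
by rewrite mcoeffD mcoeffZ !mulrDl !mulrA.
Qed.

Lemma fischerC f g : fischer f g = (fischer g f)^*.
Proof.
pose k := maxn (msize f) (msize g).
have [k1 k2] : (msize f <= k /\ msize g <= k)%N by rewrite /k !leq_max !leqnn orbT.
rewrite !(@fischerwE _ _ k) // rmorph_sum; apply: eq_bigr => m _ /=.
by rewrite !rmorphM /= conjCK rmorph_nat /= (mulrC (f@_m)).
Qed.

Lemma fischer_ge0 f : 0 <= fischer f f.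
Proof.
by apply: sumr_ge0 => m _; rewrite mulr_ge0 ?ler0n // mul_conjC_ge0.
Qed.

Lemma fischer_eq0 f : fischer f f = 0 -> f = 0.
Proof.
move/eqP; rewrite psumr_eq0 => [/allP h|m _]; last first.
  by rewrite mulr_ge0 ?ler0n // mul_conjC_ge0.
apply/mpolyP=> m; rewrite mcoeff0; case: (boolP (m \in msupp f)) => [/h|]; last first.
  by move/memN_msupp_eq0.
by rewrite /= mulf_eq0 mul_conjC_eq0 pnatr_eq0 gtn_eqF ?mnm_fact_gt0 // orbF => /eqP.
Qed.

Lemma fischerX m g : fischer 'X_[m] g = (g@_m)^* * (mnm_fact m)%:R.
Proof. by rewrite /fischer msuppX big_seq1 mcoeffX eqxx mul1r. Qed.

(** The arguments are swapped so that the linear one comes last, as the lemmas on linear maps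
    expect. *)
Let fischerl g f : C := fischer f g.
HB.instance Definition _ g :=
  GRing.isLinear.Build C {mpoly C[n]} C *%R (fischerl g) (fischer_linearl g).

Lemma fischerZl c f g : fischer (c *: f) g = c * fischer f g.
Proof. exact: (linearZ_LR (fischerl g)). Qed.

Lemma fischer_mulX i f g : fischer ('X_i * f) g = fischer f (mderiv i g).
Proof.
(* By linearity [f] may be taken to be a monomial; the factor [(m i).+1] by which the factorial
   grows is then the one produced by the derivative. *)
rewrite -!/(fischerl _ _) [f]mpolyE mulr_sumr !raddf_sum.
apply: eq_bigr => m _; rewrite -scalerAr -mpolyXD /= /fischerl !fischerZl.
rewrite !fischerX mcoeff_deriv (addmC U_(i)%MM) mnm_factS rmorphMn /= natrM mulrA.
by rewrite (mulr_natr _ (m i).+1).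
Qed.

End Fischer.

(** * Relations of the oscillator superalgebra *)

Section Letters.
Variables (C : fieldType) (E O : finType).
Local Notation superpoly := (superpoly C E O).
Local Notation osc := (oscillator C E O).
Implicit Types (f g : superpoly) (S T : {set O}) (v w : E + O) (j k : O).

Definition is_odd v : bool := if v is inr _ then true else false.

(* For j outside S, eta_j * eta_S = front_sign j S * eta_(j |: S). *)
Definition front_sign j S : {mpoly C[#|E|]} := (-1) ^+ inversions [set j] S.
Local Notation nu := front_sign.

Lemma inversions11 j k :
  inversions [set j] [set k] = (enum_rank k < enum_rank j)%N :> nat.
Proof.
rewrite /inversions.
have [lt|ge] := boolP (enum_rank k < enum_rank j)%N.
  rewrite (_ : [set _ in _ | _] = [set (j, k)]) ?cards1 //.
  apply/setP=> -[a b]; rewrite !inE /= xpair_eqE.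
  by apply/andP/andP=> [[/andP[-> ->]]|[/eqP-> /eqP->]] //; rewrite !eqxx.
apply/eqP; rewrite cards_eq0; apply/eqP/setP=> -[a b]; rewrite !inE /=.
by apply/negP=> /andP[/andP[/eqP-> /eqP->]]; apply/negP.
Qed.

(** Of two distinct odd variables exactly one precedes the other in the enumeration, so exactly one
    of the two orders costs an inversion. *)
Lemma front_signC j k : j != k -> nu j [set k] = - nu k [set j].
Proof.
move=> jk; rewrite /front_sign !inversions11.
have: enum_rank j != enum_rank k by rewrite (inj_eq enum_rank_inj).
by rewrite -(inj_eq val_inj) /=; case: ltngtP => //= _ _; rewrite ?opprK.
Qed.

Lemma front_signU1 j k T : k \notin T -> nu j (k |: T) = nu j [set k] * nu j T.
Proof.
by move=> kT; rewrite /front_sign inversionsUr ?exprD // disjoints1.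
Qed.

Lemma front_sign_sq j T : nu j T * nu j T = 1.
Proof. by rewrite /front_sign -expr2 sqrr_sign. Qed.

Lemma supervar_evenE i f S : (supervar C (inl i) * f) S = 'X_(enum_rank i) * f S.
Proof.
rewrite ffunE (bigD1 set0) ?sub0set //= big1 => [|A /andP[_ /negPf A0]].
  by rewrite ffunE eqxx addr0 inversions0l mul1r setD0.
by rewrite ffunE A0 mulr0 mul0r.
Qed.

Lemma supervar_oddE j f S : (supervar C (inr j) * f) S =
  if j \in S then nu j (S :\ j) * f (S :\ j) else 0.
Proof.
rewrite ffunE; case: ifP => jS.
  rewrite (bigD1 [set j]) ?sub1set //= big1 => [|A /andP[_ /negPf A0]].
    by rewrite ffunE eqxx addr0 mulr1.
  by rewrite ffunE A0 mulr0 mul0r.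
apply: big1 => A AS; rewrite ffunE.
case: eqP => [eA|_]; last by rewrite mulr0 mul0r.
by rewrite -sub1set -eA AS in jS.
Qed.

Definition swap_sign v w : C := (-1) ^+ (is_odd v && is_odd w).

Lemma superpolyD f g S : (f + g) S = f S + g S. Proof. by rewrite ffunE. Qed.
Lemma superpolyZ c f S : (c *: f) S = c *: f S. Proof. by rewrite ffunE. Qed.

(* Locked, so that unification never unfolds the product of superpoly. *)
Definition mulv := locked (fun v f => supervar C v * f).
Definition derv := locked (fun v f => superderiv v f).

Lemma mulvE v f : mulv v f = supervar C v * f.
Proof. by rewrite /mulv -lock. Qed.

Lemma dervE v f : derv v f = superderiv v f.
Proof. by rewrite /derv -lock. Qed.

Lemma even_mul i f S : mulv (inl i) f S = 'X_(enum_rank i) * f S.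
Proof. by rewrite mulvE supervar_evenE. Qed.

Lemma odd_mul j f S :
  mulv (inr j) f S = if j \in S then nu j (S :\ j) * f (S :\ j) else 0.
Proof. by rewrite mulvE supervar_oddE. Qed.

Lemma even_der i f S : derv (inl i) f S = mderiv (enum_rank i) (f S).
Proof. by rewrite dervE ffunE. Qed.

Lemma odd_der j f S :
  derv (inr j) f S = if j \in S then 0 else nu j S * f (j |: S).
Proof. by rewrite dervE ffunE. Qed.

Lemma mulv_comm v w f : mulv v (mulv w f) = swap_sign v w *: mulv w (mulv v f).
Proof.
case: v w => [i|j] [i'|k]; rewrite /swap_sign /= ?expr0 ?expr1 ?scale1r;
  apply/ffunP=> S.
- by rewrite !even_mul mulrCA.
- by rewrite even_mul !odd_mul even_mul; case: ifP; rewrite ?mulr0 // mulrCA.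
- by rewrite even_mul !odd_mul even_mul; case: ifP; rewrite ?mulr0 // mulrCA.
- rewrite superpolyZ scaleN1r !odd_mul !inE.
  have [->|kj] := eqVneq k j; first by case: ifP => _; rewrite ?mulr0 oppr0.
  case: (boolP (j \in S)) => jS; last by case: ifP => _; rewrite ?mulr0 oppr0.
  case: (boolP (k \in S)) => kS; last by rewrite mulr0 oppr0.
  (* Both sides read the coefficient of [f] at [T], the set without both letters; what remains to
     compare is the sign of moving one letter past the other. *)
  have eT : S :\ k :\ j = S :\ j :\ k by rewrite !setDDl setUC.
  rewrite eT; set T := S :\ j :\ k.
  have -> : S :\ j = k |: T by rewrite setD1K // !inE kj.
  have -> : S :\ k = j |: T by rewrite /T -eT setD1K // !inE eq_sym kj.
  rewrite !front_signU1 ?(front_signC kj) ?inE ?eqxx ?andbF //.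
  by rewrite /= !mulNr opprK mulrACA.
Qed.

Lemma mderiv_front_sign i j T p : mderiv i (nu j T * p) = nu j T * mderiv i p.
Proof.
by rewrite /front_sign -signr_odd !mulr_sign; case: ifP => _ //; rewrite raddfN.
Qed.

Lemma der_comm v w f : derv v (derv w f) = swap_sign v w *: derv w (derv v f).
Proof.
case: v w => [i|j] [i'|k]; rewrite /swap_sign /= ?expr0 ?expr1 ?scale1r;
  apply/ffunP=> S.
- by rewrite !even_der mderiv_comm.
- rewrite even_der !odd_der even_der.
  by case: ifP => _; rewrite ?raddf0 // mderiv_front_sign.
- rewrite even_der !odd_der even_der.
  by case: ifP => _; rewrite ?raddf0 // mderiv_front_sign.
- rewrite superpolyZ scaleN1r !odd_der !inE.
  have [->|kj] := eqVneq k j; first by case: ifP => _; rewrite ?mulr0 oppr0.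
  case: (boolP (j \in S)) => jS; first by case: ifP => _; rewrite ?orbT ?mulr0 oppr0.
  case: (boolP (k \in S)) => kS; first by rewrite mulr0 oppr0.
  rewrite /= !front_signU1 // (front_signC kj) setUCA.
  rewrite !mulNr mulrN; congr (- _); rewrite !mulrA; congr (_ * _).
  by rewrite -mulrA mulrC [_ * nu k S]mulrC.
Qed.

Lemma der_mulv v w f :
  derv v (mulv w f) = swap_sign v w *: mulv w (derv v f) + (v == w)%:R *: f.
Proof.
case: v w => [i|j] [i'|k]; rewrite /swap_sign /= ?expr0 ?expr1 ?scale1r;
  apply/ffunP=> S; rewrite superpolyD !superpolyZ.
- rewrite even_der !even_mul even_der mderivM addrC; congr (_ + _).
  rewrite mderivX mnm1E (inj_eq (@inl_inj _ _)).
  rewrite (inj_eq enum_rank_inj) eq_sym.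
  case: eqVneq => [->|_]; last by rewrite !scale0r mul0r.
  by rewrite !scale1r -{1}[U_(_)%MM]add0m addmK mpolyX0 mul1r.
- rewrite even_der !odd_mul even_der scale0r addr0.
  by case: ifP => _; rewrite ?raddf0 // mderiv_front_sign.
- rewrite even_mul !odd_der even_mul scale0r addr0.
  by case: ifP => _; rewrite ?mulr0 // mulrCA.
- rewrite scaleN1r odd_der !odd_mul odd_der !inE.
  (* For [k = j], multiplying and then differentiating keeps the coefficients with [j] outside [S],
     the opposite order those with [j] in [S]; together they give the identity. *)
  have [kj|kj] := eqVneq k j.
    rewrite kj !eqxx /=; case: (boolP (j \in S)) => jS.
      by rewrite setD1K // mulrA front_sign_sq mul1r scale1r addNr.
    by rewrite setU1K // mulrA front_sign_sq mul1r scale1r oppr0 add0r.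
  have jk : j != k by rewrite eq_sym.
  rewrite (inj_eq (@inr_inj _ _)) (negPf jk) scale0r addr0 /=.
  case: (boolP (j \in S)) => jS; first by case: ifP => _; rewrite ?mulr0 oppr0.
  case: (boolP (k \in S)) => kS; last by rewrite mulr0 oppr0.
  have -> : (j |: S) :\ k = j |: (S :\ k).
    by rewrite setDUl; congr (_ :|: _); apply/setDidPl; rewrite disjoints1 inE eq_sym.
  set T := S :\ k; have eS : S = k |: T by rewrite setD1K.
  rewrite {1}eS !front_signU1 ?inE ?eqxx // ?(negPf jS) ?andbF // (front_signC jk).
  rewrite !mulNr; congr (- _).
  by rewrite -[nu k [set j] * nu k T * _]mulrA mulrACA front_sign_sq mul1r mulrCA.
Qed.

Lemma oscP (a b : osc) : (forall f, a f = b f) -> a = b.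
Proof. by move=> ab; apply/val_inj/lendoP. Qed.

Lemma osc_mulE (a b : osc) f : (a * b) f = a (b f). Proof. by []. Qed.
Lemma osc_addE (a b : osc) f : (a + b) f = a f + b f. Proof. by []. Qed.
Lemma osc_scaleE c (a : osc) f : (c *: a) f = c *: a f. Proof. by []. Qed.
Lemma osc_oneE f : (1 : osc) f = f. Proof. by []. Qed.
Lemma osc_zeroE f : (0 : osc) f = 0. Proof. by []. Qed.
Lemma osc_varE v f : osc_var C v f = mulv v f. Proof. by rewrite mulvE. Qed.
Lemma osc_derE v f : osc_der C v f = derv v f. Proof. by rewrite dervE. Qed.

(** Generation is a predicate on operators, not on the subtype; the induction therefore carries
    along a lift of each operator to [osc]. *)
Lemma osc_ind (P : osc -> Prop) :
    (forall v, P (osc_var C v)) -> (forall v, P (osc_der C v)) -> P 1 ->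
    (forall c a b, P a -> P b -> P (c *: a + b)) ->
    (forall a b, P a -> P b -> P (a * b)) ->
  forall a, P a.
Proof.
move=> Pvar Pder P1 Plin Pmul [a aP]; have /asboolP a_gen := aP.
suff: exists b : osc, osc_val b = a /\ P b.
  by case=> b [ba]; rewrite (_ : Oscillator aP = b) //; apply: val_inj.
elim: a_gen => {aP} [v|v||c b1 b2 _ [a1 [<- P1' ]] _ [a2 [<- P2]]
  |b1 b2 _ [a1 [<- P1' ]] _ [a2 [<- P2]]].
- by exists (osc_var C v).
- by exists (osc_der C v).
- by exists 1.
- by exists (c *: a1 + a2); split=> //; apply: Plin.
- by exists (a1 * a2); split=> //; apply: Pmul.
Qed.

Lemma osc_var_comm v w :
  osc_var C v * osc_var C w = swap_sign v w *: (osc_var C w * osc_var C v).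
Proof.
by apply: oscP => f; rewrite osc_scaleE !osc_mulE !osc_varE mulv_comm.
Qed.

Lemma osc_der_comm v w :
  osc_der C v * osc_der C w = swap_sign v w *: (osc_der C w * osc_der C v).
Proof.
by apply: oscP => f; rewrite osc_scaleE !osc_mulE !osc_derE der_comm.
Qed.

Lemma osc_der_var v w :
  osc_der C v * osc_var C w =
    swap_sign v w *: (osc_var C w * osc_der C v) + (v == w)%:R *: 1.
Proof.
apply: oscP => f.
rewrite osc_addE !osc_scaleE !osc_mulE osc_oneE !(osc_varE, osc_derE).
exact: der_mulv.
Qed.

(** * Parity of polynomials and operators *)

Lemma superpoly_parity0 b : @superpoly_parity C E O b 0.
Proof. by move=> S; rewrite ffunE eqxx. Qed.

Lemma superpoly_parityP b (c : C) f g :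
  superpoly_parity b f -> superpoly_parity b g -> superpoly_parity b (c *: f + g).
Proof.
move=> fb gb S; rewrite superpolyD superpolyZ => nz.
have [f0|/fb //] := eqVneq (f S) 0.
by apply: gb; apply: contraNneq nz => ->; rewrite f0 scaler0 addr0.
Qed.

Lemma superpoly_grading : grading (@superpoly_parity C E O).
Proof.
split=> [||f|f f0 f1]; [exact: superpoly_parity0 | exact: superpoly_parityP | |].
  exists [ffun S : {set O} => if odd #|S| then 0 else f S].
  exists [ffun S : {set O} => if odd #|S| then f S else 0]; split.
  - by move=> S; rewrite ffunE; case: ifP => //; rewrite eqxx.
  - by move=> S; rewrite ffunE; case: ifP => //; rewrite eqxx.
  - by apply/ffunP=> S; rewrite !ffunE; case: ifP; rewrite ?addr0 ?add0r.
apply/ffunP=> S; rewrite ffunE; apply/eqP; apply/negPn/negP => nz.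
by move: (f0 S nz) (f1 S nz) => ->.
Qed.

Lemma mulv_parity v c f :
  superpoly_parity c f -> superpoly_parity (is_odd v (+) c) (mulv v f).
Proof.
move=> fc S; case: v => [i|j]; rewrite ?even_mul ?odd_mul.
  by move=> nz; apply: fc; apply: contraNneq nz => ->; rewrite mulr0.
case: ifP => [jS nz|]; last by rewrite eqxx.
rewrite (cardsD1 j) jS /= fc //.
by apply: contraNneq nz => ->; rewrite mulr0.
Qed.

Lemma derv_parity v c f :
  superpoly_parity c f -> superpoly_parity (is_odd v (+) c) (derv v f).
Proof.
move=> fc S; case: v => [i|j]; rewrite ?even_der ?odd_der.
  by move=> nz; apply: fc; apply: contraNneq nz => ->; rewrite raddf0.
case: ifP => [|jS nz]; first by rewrite eqxx.
rewrite /= -(fc (j |: S)) ?cardsU1 ?jS ?oddD //= ?negbK //.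
by apply: contraNneq nz => ->; rewrite mulr0.
Qed.

Lemma osc_var_parity v : osc_parity (is_odd v) (osc_var C v).
Proof. by move=> c f fc; rewrite osc_varE; apply: mulv_parity. Qed.

Lemma osc_der_parity v : osc_parity (is_odd v) (osc_der C v).
Proof. by move=> c f fc; rewrite osc_derE; apply: derv_parity. Qed.

Lemma osc_parity0 b : @osc_parity C E O b 0.
Proof. by move=> c f _; apply: superpoly_parity0. Qed.

Lemma osc_parityP b (c : C) (x y : osc) :
  osc_parity b x -> osc_parity b y -> osc_parity b (c *: x + y).
Proof.
move=> xb yb e f fe; rewrite osc_addE osc_scaleE.
by apply: superpoly_parityP; [apply: xb | apply: yb].
Qed.

Lemma osc_parity1 : @osc_parity C E O false 1.
Proof. by []. Qed.

Lemma osc_parityM b c (x y : osc) :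
  osc_parity b x -> osc_parity c y -> osc_parity (b (+) c) (x * y).
Proof. by move=> xb yc e f fe; rewrite -addbA; apply/xb/yc. Qed.

Lemma osc_superalgebra : superalgebra (@osc_parity C E O).
Proof.
split; [split | exact: osc_parity1 | exact: osc_parityM].
- exact: osc_parity0.
- exact: osc_parityP.
- have P v (a : osc) : osc_parity (is_odd v) a -> exists a0 a1,
      [/\ osc_parity false a0, osc_parity true a1 & a = a0 + a1].
    case: v => [i|j] /= av; [exists a, 0 | exists 0, a]; split=> //;
      rewrite ?addr0 ?add0r //; exact: osc_parity0.
  elim/osc_ind => [v|v||c a b [a0 [a1 [ha0 ha1 ->]]] [b0 [b1 [hb0 hb1 ->]]]
    |a b [a0 [a1 [ha0 ha1 ->]]] [b0 [b1 [hb0 hb1 ->]]]].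
  + exact/P/osc_var_parity.
  + exact/P/osc_der_parity.
  + exists 1, 0; rewrite addr0; split=> //.
    exact: osc_parity0.
  + exists (c *: a0 + b0), (c *: a1 + b1).
    by rewrite scalerDr addrACA; split=> //; apply: osc_parityP.
  + exists (1 *: (a0 * b0) + a1 * b1), (1 *: (a0 * b1) + a1 * b0).
    split; rewrite ?scale1r.
    * rewrite -[a0 * b0]scale1r; apply: osc_parityP.
        exact: (@osc_parityM false false).
      exact: (@osc_parityM true true).
    * rewrite -[a0 * b1]scale1r; apply: osc_parityP.
        exact: (@osc_parityM false true).
      exact: (@osc_parityM true false).
    * by rewrite mulrDl !mulrDr [a1 * b0 + _]addrC addrACA.
(* An operator that is both even and odd sends each homogeneous polynomial into both components,
   hence to 0. *)
- move=> a a0 a1; apply: oscP => f; rewrite osc_zeroE.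
  have [_ _ dec dir] := superpoly_grading.
  have [f0 [f1 [h0 h1 ->]]] := dec f; rewrite linearD /=.
  rewrite (dir (a f0) (a0 false _ h0) (a1 false _ h0)).
  by rewrite (dir (a f1) (a1 true _ h1) (a0 true _ h1)) addr0.
Qed.

End Letters.

(** * The contravariant form and the adjoint *)

Section OscillatorForm.
Variables (C : numClosedFieldType) (E O : finType).
Local Notation superpoly := (superpoly C E O).
Local Notation osc := (oscillator C E O).
Implicit Types (f g h : superpoly) (S T : {set O}) (v w : E + O).

Definition sform f g : C := \sum_(S : {set O}) fischer (f S) (g S).

Lemma sform_linearl g : linear_for *%R (sform^~ g).
Proof.
move=> c f h; rewrite /sform mulr_sumr -big_split; apply: eq_bigr => S _ /=.
by rewrite superpolyD superpolyZ fischer_linearl.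
Qed.

Lemma sformC f g : sform f g = (sform g f)^*.
Proof. by rewrite rmorph_sum; apply: eq_bigr => S _; apply: fischerC. Qed.

Lemma sform_linearr f : linear_for (Num.conj \; *%R) (sform f).
Proof.
move=> c g h; rewrite sformC sform_linearl rmorphD rmorphM /=.
by rewrite -!sformC.
Qed.

HB.instance Definition _ := bilinear_isBilinear.Build C superpoly superpoly C
  *%R (Num.conj \; *%R) sform (sform_linearl, sform_linearr).

Fact sform_hermitian f g : sform f g = (-1) ^+ false * (sform g f)^*.
Proof. by rewrite expr0 mul1r sformC. Qed.

HB.instance Definition _ := isHermitianSesquilinear.Build C superpoly
  false Num.conj sform sform_hermitian.

Lemma sform_gt0 f : f != 0 -> 0 < sform f f.
Proof.
move=> nz; rewrite lt_def sumr_ge0 ?andbT => [|S _]; last exact: fischer_ge0.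
apply: contraNneq nz => /eqP.
rewrite psumr_eq0 => [/allP h|S _]; last exact: fischer_ge0.
apply/eqP/ffunP=> S; rewrite ffunE; apply: fischer_eq0; apply/eqP.
by apply: h; rewrite mem_index_enum.
Qed.

Lemma fischer_front_sign (j : O) S p q :
  fischer (front_sign C E j S * p) q = fischer p (front_sign C E j S * q).
Proof.
rewrite /front_sign -signr_odd !mulr_sign; case: ifP => _ //.
by rewrite -!scaleN1r fischerZl [RHS]fischerC fischerZl rmorphM /= -fischerC rmorphN1.
Qed.

(** For an odd letter [j], adding [j] is a bijection from the sets without [j] to the sets with [j].
    Multiplication and derivation follow it in opposite directions with the same real sign, so they
    are transposes of each other. *)
Lemma sform_mulv v f g : sform (mulv v f) g = sform f (derv v g).
Proof.
case: v => [i|j].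
  by apply: eq_bigr => S _; rewrite even_mul even_der fischer_mulX.
rewrite /sform (bigID (fun S => j \in S)) /= addrC big1 ?add0r => [|S jS]; last first.
  by rewrite odd_mul (negPf jS) /fischer msupp0 big_nil.
rewrite [RHS](bigID (fun S => j \in S)) /= [X in _ = X + _]big1 ?add0r => [|S jS]; last first.
  by rewrite odd_der jS fischerC /fischer msupp0 big_nil rmorph0.
rewrite (reindex_onto (fun S => j |: S) (fun S => S :\ j)) /= => [|S jS]; last first.
  exact: setD1K.
apply: eq_big => [S|S jS].
  rewrite setU11 /=; apply/eqP/idP => [<-|]; first by rewrite !inE eqxx.
  exact: setU1K.
move: jS => /andP[_ /eqP jS]; have {}jS : j \notin S by rewrite -jS !inE eqxx.
by rewrite odd_mul odd_der setU11 setU1K // (negPf jS) fischer_front_sign.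
Qed.

Lemma sform_derv v f g : sform (derv v f) g = sform f (mulv v g).
Proof. by rewrite sformC -sform_mulv -sformC. Qed.

(** Products of letters applied to 1 span the space; a form is thereby determined by its
    contravariance under single letters. *)
Lemma superpoly_ind (P : superpoly -> Prop) :
    P 1 -> (forall c f g, P f -> P g -> P (c *: f + g)) ->
    (forall v f, P f -> P (mulv v f)) ->
  forall f, P f.
Proof.
move=> P1 Plin Pmul.
have P0 : P 0 by rewrite -(addNr 1) -scaleN1r; apply: Plin.
(* [e S p] is the product of [p] with the odd monomial [eta_S]. *)
pose e S (p : {mpoly C[#|E|]}) : superpoly :=
  [ffun T : {set O} => if T == S then p else 0].
have eP S c p q : e S (c *: p + q) = c *: e S p + e S q.
  apply/ffunP=> T; rewrite superpolyD superpolyZ !ffunE.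
  by case: ifP => _; rewrite ?scaler0 ?addr0.
have e0 S : e S 0 = 0 by apply/ffunP=> T; rewrite !ffunE if_same.
have eX i k p : P (e set0 p) -> P (e set0 ('X_i ^+ k * p)).
  move=> Pp; elim: k => [|k IH]; first by rewrite expr0 mul1r.
  rewrite exprS -mulrA.
  suff -> : e set0 ('X_i * ('X_i ^+ k * p)) =
      mulv (inl (enum_val i)) (e set0 ('X_i ^+ k * p)) by apply: Pmul.
  apply/ffunP=> T; rewrite even_mul !ffunE enum_valK.
  by case: ifP => _; rewrite ?mulr0.
have Pe S p : P (e S p).
  move: p; have [k] := ubnP #|S|; elim: k S => // k IH S kS p.
  have [->|[j jS]] := set_0Vmem S.
    elim/mpolyind: p => [|c m p _ _ Pp]; first by rewrite e0.
    rewrite eP; apply: Plin => //; rewrite mpolyXE_id.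
    elim/big_rec: _ => [|i q _]; last exact: eX.
    rewrite (_ : e _ _ = 1) //; apply/ffunP=> T; rewrite !ffunE.
    by case: ifP.
  (* Putting [j] back in front costs a sign; it is inserted into the coefficient beforehand, as its
     square is 1. *)
  suff -> : e S p = mulv (inr j) (e (S :\ j) (front_sign C E j (S :\ j) * p)).
    by apply/Pmul/IH; move: kS; rewrite (cardsD1 j) jS.
  apply/ffunP=> T; rewrite odd_mul !ffunE; case: (eqVneq T S) => [->|TS].
    by rewrite jS eqxx mulrA front_sign_sq mul1r.
  case: ifP => // jT; rewrite ifN ?mulr0 //; apply: contraNneq TS => eTS.
  by rewrite -(setD1K jT) -(setD1K jS) eTS.
move=> f; have -> : f = \sum_(S : {set O}) e S (f S).
  apply/ffunP=> T; rewrite sum_ffunE (bigD1 T) //= big1 ?addr0 => [|S /negPf ST].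
    by rewrite ffunE eqxx.
  by rewrite ffunE eq_sym ST.
elim/big_rec: _ => [|S g _ Pg]; first exact: P0.
by rewrite -[e S _]scale1r; apply: Plin.
Qed.

(** * Existence and uniqueness of adjoints *)

Lemma sform_adjoint_unique (b b' : osc) :
  (forall f g, sform f (b g) = sform f (b' g)) -> b = b'.
Proof.
move=> h; apply: oscP => g; apply/eqP; rewrite -subr_eq0; apply/negPn/negP.
(* The difference [b g - b' g] is orthogonal to every vector, in particular to itself. *)
move/sform_gt0; set f := b g - b' g; rewrite {2}/f.
by rewrite addrC -scaleN1r sform_linearr /= rmorphN1 mulN1r h addNr ltxx.
Qed.

Lemma sform_adjoint_exists (a : osc) :
  exists b : osc, forall f g, sform (a f) g = sform f (b g).
Proof.
elim/osc_ind: a => [v|v||c a1 a2 [b1 h1] [b2 h2]|a1 a2 [b1 h1] [b2 h2]].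
- by exists (osc_der C v) => f g; rewrite osc_varE osc_derE sform_mulv.
- by exists (osc_var C v) => f g; rewrite osc_varE osc_derE sform_derv.
- by exists 1.
- exists (c^* *: b1 + b2) => f g; rewrite !(osc_addE, osc_scaleE).
  by rewrite sform_linearl sform_linearr /= conjCK h1 h2.
- by exists (b2 * b1) => f g; rewrite !osc_mulE h1 h2.
Qed.

Definition adjoint (a : osc) : osc := projT1 (cid (sform_adjoint_exists a)).

Lemma adjointP (a : osc) f g : sform (a f) g = sform f (adjoint a g).
Proof. by rewrite /adjoint; case: cid. Qed.

Lemma adjoint_eq (a b : osc) :
  (forall f g, sform (a f) g = sform f (b g)) -> adjoint a = b.
Proof. by move=> h; apply: sform_adjoint_unique => f g; rewrite -adjointP. Qed.

Lemma adjoint_var v : adjoint (osc_var C v) = osc_der C v.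
Proof.
by apply: adjoint_eq => f g; rewrite osc_varE osc_derE sform_mulv.
Qed.

Lemma adjoint_der v : adjoint (osc_der C v) = osc_var C v.
Proof.
by apply: adjoint_eq => f g; rewrite osc_varE osc_derE sform_derv.
Qed.

(** Each rule exhibits an adjoint and concludes by uniqueness; for involutivity, Hermitian symmetry
    exchanges the two arguments. *)
Lemma adjoint_anti : anti_involution adjoint.
Proof.
split=> [c a b|a b|a]; apply: adjoint_eq => f g.
- rewrite !(osc_addE, osc_scaleE) sform_linearl sform_linearr /= conjCK.
  by rewrite !adjointP.
- by rewrite !osc_mulE !adjointP.
- by rewrite sformC -adjointP -sformC.
Qed.

(** Unitality is not a clause of [anti_involution]; it results from applying [w] to [1 * w 1]. *)
Lemma anti_involution1 (A : algType C) (w : A -> A) :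
  anti_involution w -> w 1 = 1.
Proof. by case=> _ wM wK; rewrite -[LHS]mul1r -{1}(wK 1) -wM mul1r wK. Qed.

Lemma osc_anti_involution_unique (w w' : osc -> osc) :
    anti_involution w -> anti_involution w' ->
    (forall v, w (osc_var C v) = w' (osc_var C v)) ->
    (forall v, w (osc_der C v) = w' (osc_der C v)) ->
  w = w'.
Proof.
move=> hw hw' hvar hder; apply: funext; elim/osc_ind => [v|v||c a b wa wb|a b wa wb] //.
- by rewrite !anti_involution1.
- by case: hw hw' => [wl _ _] [wl' _ _]; rewrite wl wl' wa wb.
- by case: hw hw' => [_ wM _] [_ wM' _]; rewrite wM wM' wa wb.
Qed.

Lemma derv1 v : derv v (1 : superpoly) = 0.
Proof.
apply/ffunP=> S; case: v => [i|j]; rewrite ?even_der ?odd_der !ffunE.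
  by case: eqP => _; [rewrite -[1%:R]/(1%:MP) mderivC | rewrite raddf0].
case: ifP => // jS; rewrite (_ : _ == set0 = false) ?mulr0 //.
by apply/negbTE/set0Pn; exists j; rewrite setU11.
Qed.

Lemma sform11 : sform 1 1 = 1.
Proof.
rewrite /sform (bigD1 set0) //= big1 ?addr0 => [|S /negPf S0]; last first.
  by rewrite ffunE S0 /fischer msupp0 big_nil.
rewrite !ffunE eqxx /= -mpolyX0 fischerX mcoeffX eqxx rmorph1 mul1r.
by rewrite /mnm_fact big1 // => i _; rewrite mnm0E.
Qed.

(** Variables in the left argument become derivatives on the right, which reduces the left argument
    to 1. Hermitian symmetry then brings a variable of the right argument to the left, and the
    resulting derivative kills 1. *)
Lemma sform_unique (form : hermitian_form superpoly) :
    (forall v f g, form (mulv v f) g = form f (derv v g)) -> form 1 1 = 1 ->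
  form =2 sform.
Proof.
move=> hform h11 f g; elim/superpoly_ind: f g => [|c f1 f2 h1 h2|v f h] g.
- elim/superpoly_ind: g => [|c f1 f2 h1 h2|v f h].
  + by rewrite h11 sform11.
  + by rewrite linearPr /= sform_linearr h1 h2.
  + have h1 : form 1 (mulv v f) = (form (mulv v f) 1)^*.
      by rewrite [LHS]hermitian_subproof expr0 mul1r.
    by rewrite h1 hform sformC sform_mulv derv1 !linear0r.
- by rewrite linearPl /= sform_linearl h1 h2.
- by rewrite hform sform_mulv.
Qed.

End OscillatorForm.

(** * Enveloping superalgebras *)

Section EnvelopingAlgebra.
Variables (C : fieldType) (L : lmodType C).
Variables (gr : bool -> L -> Prop) (br : L -> L -> L).
Local Notation U := (uea gr br).
Local Notation gen := (uea_gen gr br).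
Local Notation upar := (@uea_parity C L gr br).

Lemma uea_gen_linear : linear gen.
Proof.
move=> c x y; rewrite /uea_gen (uea_eq (UeqGen _ _ c x y)).
by rewrite -uea_addE -uea_mulE.
Qed.

Lemma uea_gen0 : gen 0 = 0.
Proof. by rewrite -(addNr 0) -scaleN1r uea_gen_linear scaleN1r addNr. Qed.

Lemma uea_genZ c x : gen (c *: x) = c *: gen x.
Proof. by rewrite -[c *: x]addr0 uea_gen_linear uea_gen0 addr0. Qed.

Lemma uea_gen_bracket b c x y : gr b x -> gr c y ->
  gen x * gen y - (-1) ^+ (b && c) *: (gen y * gen x) = gen (br x y).
Proof.
move=> bx cy; rewrite [RHS]/uea_gen -(uea_eq (UeqBracket br bx cy)).
by rewrite -uea_addE -!uea_mulE -scaleNr.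
Qed.

Lemma uea_generated_ind (P : U -> Prop) :
    (forall x, P (gen x)) -> P 1 ->
    (forall c u v, P u -> P v -> P (c *: u + v)) ->
    (forall u v, P u -> P v -> P (u * v)) ->
  forall u, P u.
Proof.
move=> Pgen P1 Plin Pmul; elim/uea_ind; elim=> [x|c|s IHs t IHt|s IHs t IHt].
- exact: Pgen.
- have P0 : P 0 by rewrite -(addNr 1) -scaleN1r; apply: Plin.
  suff -> : \pi_U (UScal L c) = c *: (1 : U) + 0 by apply: Plin.
  by rewrite addr0; apply/esym/(mulr1 (uea_scal gr br c)).
- by rewrite -uea_addE -[uea_add _ _]/(_ + _ : U) -[\pi_U s]scale1r; apply: Plin.
- by rewrite -uea_mulE; apply: Pmul.
Qed.

(* The scalars act on B through kappa: with B the converse ring and kappa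
   the conjugation this also produces antilinear anti-homomorphisms. *)
Section Lift.
Variables (B : pzRingType) (kappa : {rmorphism C -> B}) (f : L -> B).
Hypothesis kappaC : forall c x, kappa c * x = x * kappa c.
Hypothesis f_linear : forall c x y, f (c *: x + y) = kappa c * f x + f y.
Hypothesis f_bracket : forall b c x y, gr b x -> gr c y ->
  f x * f y - kappa ((-1) ^+ (b && c)) * (f y * f x) = f (br x y).

Fixpoint uexpr_eval (s : uexpr L) : B :=
  match s with
  | UGen x => f x
  | UScal c => kappa c
  | UAdd s t => uexpr_eval s + uexpr_eval t
  | UMul s t => uexpr_eval s * uexpr_eval t
  end.

Lemma uexpr_eval_eq s t : ueq gr br s t -> uexpr_eval s = uexpr_eval t.
Proof.
elim=> {s t} //=.
- by move=> s t u _ -> _ ->.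
- by move=> s s' t t' _ -> _ ->.
- by move=> s s' t t' _ -> _ ->.
- by move=> *; rewrite addrA.
- by move=> *; rewrite addrC.
- by move=> *; rewrite rmorph0 add0r.
- by move=> *; rewrite rmorphN1 rmorph0 mulN1r addNr.
- by move=> *; rewrite mulrA.
- by move=> *; rewrite rmorph1 mul1r.
- by move=> *; rewrite mulrDl.
- by move=> *; rewrite mulrDr.
- by move=> *; rewrite rmorphD.
- by move=> *; rewrite rmorphM.
- by move=> b c x y bx cy; rewrite rmorphN mulNr f_bracket.
Qed.

(** The universal property: [F] evaluates a representative, and since [B] satisfies every relation
    of [ueq], the choice of representative does not matter. *)
Lemma uea_lift : exists F : U -> B,
  [/\ forall c u v, F (c *: u + v) = kappa c * F u + F v, F 1 = 1,
      forall u v, F (u * v) = F u * F v & forall x, F (gen x) = f x].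
Proof.
pose F (u : U) := uexpr_eval (repr u).
have Fpi s : F (\pi_U s) = uexpr_eval s by apply/uexpr_eval_eq/uea_repr.
have FM u v : F (u * v) = F u * F v.
  elim/uea_ind: u => s; elim/uea_ind: v => t.
  by rewrite [_ * _]uea_mulE !Fpi.
exists F; split=> [c u v|||x] //; last 2 first.
- by rewrite Fpi /= rmorph1.
- by rewrite Fpi.
rewrite -[c *: u]/(uea_scal gr br c * u) -[kappa c]/(uexpr_eval (UScal L c)) -Fpi -FM.
move: (_ * u) => {}u; elim/uea_ind: u => s; elim/uea_ind: v => t.
by rewrite [_ + _]uea_addE !Fpi.
Qed.

End Lift.

(** * The grading of the enveloping superalgebra *)

Lemma uea_parity_hom (A : algType C) (grA : bool -> A -> Prop) (F : U -> A) :
    superalgebra grA -> linear F -> monoid_morphism F ->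
    (forall b x, gr b x -> grA b (F (gen x))) ->
  superalgebra_hom upar grA F.
Proof.
move=> [[A0 Alin _ _] A1 AM] Flin Fmul Fgen; split=> // b u.
case: Fmul => F1 FM.
elim=> {b u} [b x|| b|b c x y _ IHx _ IHy|b c x y _ IHx _ IHy].
- exact: Fgen.
- by rewrite F1.
- have -> : F 0 = 0; last exact: A0.
  by rewrite -(addNr (1 : U)) -scaleN1r Flin F1 scaleN1r addNr.
- by rewrite Flin; apply: Alin.
- by rewrite FM; apply: AM.
Qed.

(** This is the parity automorphism. The two components of a vector are chosen, and directness of
    the grading makes their difference independent of the choice, hence linear. *)
Lemma grading_sign : grading gr -> exists2 theta : L -> L, linear theta &
  forall b x, gr b x -> theta x = (-1) ^+ b *: x.
Proof.
move=> [gr0 grlin dec dir].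
have grN b x : gr b x -> gr b (- x).
  by move=> bx; rewrite -[- x]addr0 -scaleN1r; apply: grlin.
have grB b x y : gr b x -> gr b y -> gr b (x - y).
  by move=> bx yb; rewrite -[x]scale1r; apply: grlin => //; apply: grN.
have uniq_dec x0 x1 y0 y1 : gr false x0 -> gr true x1 -> gr false y0 ->
    gr true y1 -> x0 + x1 = y0 + y1 -> x0 - x1 = y0 - y1.
  move=> gx0 gx1 gy0 gy1 exy.
  have e : x0 - y0 = y1 - x1.
    by apply/eqP; rewrite subr_eq addrAC eq_sym subr_eq eq_sym exy addrC.
  have z : x0 - y0 = 0 by apply: dir; [|rewrite e]; apply: grB.
  move: e; rewrite z => /esym/eqP; rewrite subr_eq0 => /eqP ->.
  by move/eqP: z; rewrite subr_eq0 => /eqP ->.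
have decP x : {x01 : L * L | [/\ gr false x01.1, gr true x01.2 & x = x01.1 + x01.2]}.
  by apply: cid; have [x0 [x1 h]] := dec x; exists (x0, x1).
pose theta x := (sval (decP x)).1 - (sval (decP x)).2.
exists theta => [c x y|b x bx]; rewrite /theta.
  case: (decP (c *: x + y)) (decP x) (decP y) => [[u0 u1] /= [gu0 gu1 eu]].
  move=> [[x0 x1] /= [gx0 gx1 ex]] [[y0 y1] /= [gy0 gy1 ey]].
  rewrite scalerBr addrACA -opprD; apply: uniq_dec => //; try exact: grlin.
  by rewrite -eu ex ey scalerDr addrACA.
case: (decP x) => [[x0 x1] /= [gx0 gx1 ex]].
case: b bx => bx; rewrite ?expr1 ?expr0 ?scaleN1r ?scale1r.
  by rewrite -[RHS]add0r; apply: uniq_dec => //; rewrite add0r.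
by rewrite -[RHS]subr0; apply: uniq_dec => //; rewrite addr0.
Qed.

(** Since [uea_parity] is generated inductively, directness is not visible from its clauses. The
    sign map of [L] respects the bracket, so it lifts to an endomorphism of the enveloping algebra
    that acts by [(-1) ^+ b] on parity [b]. *)
Lemma uea_superalgebra : grading gr ->
    (forall b c x y, gr b x -> gr c y -> gr (b (+) c) (br x y)) ->
    (2 : C) != 0 ->
  superalgebra upar.
Proof.
move=> ggr grbr two; split; last 2 first.
- exact: UparOne.
- by move=> b c x y; apply: UparMul.
have [_ _ dec _] := ggr.
split=> [b|b c u v|u|u u0 u1]; [exact: UparZero | exact: UparLin | |].
  elim/uea_generated_ind: u => [x||c u v [u0 [u1 [gu0 gu1 ->]]] [v0 [v1 [gv0 gv1 ->]]]
    |u v [u0 [u1 [gu0 gu1 ->]]] [v0 [v1 [gv0 gv1 ->]]]].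
  - have [x0 [x1 [gx0 gx1 ->]]] := dec x; exists (gen x0), (gen x1).
    split; try exact: UparGen.
    by rewrite -[x0]scale1r uea_gen_linear !scale1r.
  - exists 1, 0; rewrite addr0; split=> //; [exact: UparOne | exact: UparZero].
  - exists (c *: u0 + v0), (c *: u1 + v1).
    by rewrite scalerDr addrACA; split=> //; apply: UparLin.
  - exists (1 *: (u0 * v0) + u1 * v1), (1 *: (u0 * v1) + u1 * v0); split.
    + apply: UparLin; first exact: (@UparMul _ _ _ _ false false).
      exact: (@UparMul _ _ _ _ true true).
    + apply: UparLin; first exact: (@UparMul _ _ _ _ false true).
      exact: (@UparMul _ _ _ _ true false).
    + by rewrite !scale1r mulrDl !mulrDr [u1 * v0 + _]addrC addrACA.
have [theta tlin tgr] := grading_sign ggr.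
have [|||F [Flin F1 FM Fgen]] :=
  @uea_lift U (in_alg U) (fun x => gen (theta x)).
- by move=> c x; rewrite /= -scalerAl -scalerAr mul1r mulr1.
- by move=> c x y; rewrite tlin uea_gen_linear /= -scalerAl mul1r.
- move=> b c x y bx cy.
  rewrite (tgr _ _ bx) (tgr _ _ cy) (tgr _ _ (grbr _ _ _ _ bx cy)).
  rewrite !uea_genZ -(uea_gen_bracket bx cy) signr_addb /= -!scalerAl -!scalerAr mul1r.
  rewrite !scalerA scalerBr scalerA; congr (_ - _ *: _).
  by rewrite mulrC [_ ^+ c * _]mulrC.
have Fpar b v : upar b v -> F v = (-1) ^+ b *: v.
  elim=> {b v} [b x bx||b|b c x y _ IHx _ IHy|b c x y _ IHx _ IHy].
  - by rewrite Fgen (tgr _ _ bx) uea_genZ.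
  - by rewrite F1 scale1r.
  - by rewrite scaler0 -(addNr (1 : U)) -scaleN1r Flin F1 rmorphN1 mulN1r addNr.
  - by rewrite Flin IHx IHy scalerDr /= -scalerAl mul1r !scalerA mulrC.
  - by rewrite FM IHx IHy signr_addb -scalerAl -scalerAr scalerA.
(* An element of both parities satisfies [u = - u], and 2 is invertible. *)
have := Fpar _ _ u0; rewrite (Fpar _ _ u1) expr1 expr0 scaleN1r scale1r => /esym/eqP.
by rewrite -addr_eq0 -mulr2n -scaler_nat scaler_eq0 (negPf two) => /eqP.
Qed.

End EnvelopingAlgebra.

(** * Quadratic operators *)

Section Quadratic.
Variables (C : fieldType) (A : algType C) (J : finType) (par : J -> bool).
Variables (P Q : J -> A).
Implicit Types (M : J -> J -> C) (x y : J * J).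

Local Notation s j k := ((-1) ^+ (par j && par k) : C).

Hypothesis PP : forall j k, P j * P k = s j k *: (P k * P j).
Hypothesis QQ : forall j k, Q j * Q k = s j k *: (Q k * Q j).
Hypothesis QP : forall j k, Q j * P k = s j k *: (P k * Q j) + (j == k)%:R *: 1.

Definition quad M : A := \sum_x M x.1 x.2 *: (P x.1 * Q x.2).
Definition kmul M M' : J -> J -> C := fun j k => \sum_l M j l * M' l k.
Definition khomog (b : bool) M : Prop :=
  forall j k, M j k != 0 -> par j (+) par k = b.

Lemma quad_linear c M M' :
  quad (fun j k => c * M j k + M' j k) = c *: quad M + quad M'.
Proof.
rewrite /quad scaler_sumr -big_split; apply: eq_bigr => x _ /=.
by rewrite scalerDl scalerA.
Qed.

(** [E] brings each product into the order P P Q Q. By [PP] and [QQ] the two quartic terms differ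
    exactly by the sign of the superbracket and cancel; the contractions from [QP] remain. *)
Lemma quad_monomial_bracket j k j' k'
    (t := (par j (+) par k) && (par j' (+) par k')) :
  P j * Q k * (P j' * Q k') - (-1) ^+ t *: (P j' * Q k' * (P j * Q k)) =
  (k == j')%:R *: (P j * Q k') - (-1) ^+ t *: ((k' == j)%:R *: (P j' * Q k)).
Proof.
have E i l i' l' : P i * Q l * (P i' * Q l') =
    s l i' *: (P i * P i' * (Q l * Q l')) + (l == i')%:R *: (P i * Q l').
  rewrite mulrA -[P i * Q l * P i']mulrA QP mulrDr mulrDl.
  by rewrite -!scalerAr -!scalerAl mulr1 !mulrA.
rewrite !E PP QQ -!scalerAl -!scalerAr !scalerA scalerDr !scalerA opprD addrACA.
rewrite -[RHS]add0r; congr (_ + _); apply/eqP; rewrite subr_eq0; apply/eqP.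
congr (_ *: _); rewrite /t.
rewrite -!signr_addb; congr (_ ^+ nat_of_bool _).
by case: (par j); case: (par k); case: (par j'); case: (par k').
Qed.

Lemma quad_mul M M' : quad M * quad M' =
  \sum_x \sum_y (M x.1 x.2 * M' y.1 y.2) *: (P x.1 * Q x.2 * (P y.1 * Q y.2)).
Proof.
rewrite /quad mulr_suml; apply: eq_bigr => x _; rewrite mulr_sumr.
by apply: eq_bigr => y _; rewrite -scalerAl -scalerAr scalerA.
Qed.

(** The matrix product is spread over pairs of entries, with the contraction written as a Kronecker
    delta, so that it matches [quad_mul] term by term. *)
Lemma quad_kmul M M' : quad (kmul M M') =
  \sum_x \sum_y (M x.1 x.2 * M' y.1 y.2) *: ((x.2 == y.1)%:R *: (P x.1 * Q y.2)).
Proof.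
transitivity (\sum_j \sum_k \sum_l (M j l * M' l k) *: (P j * Q k)).
  rewrite pair_bigA; apply: eq_bigr => x _ /=.
  by rewrite scaler_suml.
rewrite -(pair_bigA _ (fun j l => \sum_y (M j l * M' y.1 y.2) *:
   ((l == y.1)%:R *: (P j * Q y.2)))) /=.
apply: eq_bigr => j _; rewrite exchange_big; apply: eq_bigr => l _.
rewrite -(pair_bigA _ (fun l' k => (M j l * M' l' k) *:
   ((l == l')%:R *: (P j * Q k)))) /= exchange_big.
apply: eq_bigr => k _; rewrite (bigD1 l) //= eqxx scale1r big1 ?addr0 // => l' ll'.
by rewrite eq_sym (negPf ll') scale0r scaler0.
Qed.

Lemma quad_bracket b c M M' : khomog b M -> khomog c M' ->
  quad M * quad M' - (-1) ^+ (b && c) *: (quad M' * quad M) =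
  quad (fun j k => kmul M M' j k - (-1) ^+ (b && c) * kmul M' M j k).
Proof.
move=> hM hM'.
have -> : quad (fun j k => kmul M M' j k - (-1) ^+ (b && c) * kmul M' M j k) =
    quad (kmul M M') - (-1) ^+ (b && c) *: quad (kmul M' M).
  rewrite addrC -scaleNr -quad_linear; apply: eq_bigr => x _.
  by rewrite mulNr addrC.
(* The reversed products are summed in the opposite order, so that all sums run over the same [x]
   and [y]. *)
rewrite !quad_mul !quad_kmul [in X in _ - _ *: X = _]exchange_big.
rewrite [in X in _ = _ - _ *: X]exchange_big !scaler_sumr -!sumrB.
apply: eq_bigr => x _; rewrite !scaler_sumr -!sumrB; apply: eq_bigr => y _.
(* A nonzero entry has the parity of its matrix, so the global sign given by [b && c] is the sign of
   the monomial bracket. *)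
have [->|nzM] := eqVneq (M x.1 x.2) 0.
  by rewrite mul0r mulr0 !scale0r !scaler0.
have [->|nzM'] := eqVneq (M' y.1 y.2) 0.
  by rewrite mul0r mulr0 !scale0r !scaler0.
rewrite [M' _ _ * _]mulrC !(scalerA ((-1) ^+ _) (_ * _)).
rewrite ![(-1) ^+ _ * (M _ _ * _)]mulrC -!scalerA -!scalerBr; do 2!congr (_ *: _).
by rewrite -(hM _ _ nzM) -(hM' _ _ nzM') quad_monomial_bracket.
Qed.

End Quadratic.

(** * Variables and derivatives as supercommuting pairs *)

Section LetterPairs.
Variables (C : fieldType) (E O J : finType).
Variables (letter : J -> E + O) (left : pred J).
Hypothesis letter_inj : injective letter.
Local Notation osc := (oscillator C E O).
Local Notation par := (fun j => is_odd (letter j)).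

Definition left_sign j : C := if left j then (-1) ^+ is_odd (letter j) else -1.

Definition osc_P j : osc :=
  if left j then osc_der C (letter j) else osc_var C (letter j).
(** The factor is -1 for an even letter on the left and 1 in all other cases; it normalizes the
    constant in [oscQP] to 1. *)
Definition osc_Q j : osc :=
  - left_sign j *: (if left j then osc_var C (letter j) else osc_der C (letter j)).

Lemma left_sign_sq j : left_sign j * left_sign j = 1.
Proof.
by rewrite /left_sign; case: ifP => _; rewrite ?mulrNN ?mulr1 // -expr2 sqrr_sign.
Qed.

Lemma swap_sign_sq (v w : E + O) : swap_sign C v w * swap_sign C v w = 1.
Proof. by rewrite /swap_sign -expr2 sqrr_sign. Qed.

Lemma swap_signC (v w : E + O) : swap_sign C v w = swap_sign C w v.
Proof. by rewrite /swap_sign andbC. Qed.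

Lemma osc_var_der v w : osc_var C v * osc_der C w =
  swap_sign C v w *: (osc_der C w * osc_var C v)
  - ((v == w)%:R * swap_sign C v w) *: (1 : osc).
Proof.
rewrite osc_der_var scalerDr scalerA (swap_signC w v) swap_sign_sq scale1r.
by rewrite scalerA eq_sym mulrC addrK.
Qed.

(** In [oscPP] and [oscQQ] a variable meets a derivative only when [j] and [k] lie on different
    sides; the letters are then distinct, and exchanging them produces no constant. *)
Let ne_letter j k : left j != left k -> (letter j == letter k) = false.
Proof.
by move=> jk; apply: contraNF jk => /eqP/letter_inj ->.
Qed.

Lemma oscPP j k : osc_P j * osc_P k =
  (-1) ^+ (par j && par k) *: (osc_P k * osc_P j).
Proof.
rewrite -/(swap_sign C (letter j) (letter k)) /osc_P.
have := @ne_letter j k; case: (left j) (left k) => [] [] /= ne.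
- exact: osc_der_comm.
- by rewrite osc_der_var ne // scale0r addr0.
- by rewrite osc_var_der ne // mul0r scale0r subr0.
- exact: osc_var_comm.
Qed.

Let scaleM (a b : C) (x y : osc) : (a *: x) * (b *: y) = (a * b) *: (x * y).
Proof. by rewrite -scalerAl -scalerAr scalerA. Qed.

Lemma oscQQ j k : osc_Q j * osc_Q k =
  (-1) ^+ (par j && par k) *: (osc_Q k * osc_Q j).
Proof.
rewrite -/(swap_sign C (letter j) (letter k)) /osc_Q !scaleM.
set a := - left_sign j; set b := - left_sign k.
rewrite (mulrC b) scalerA (mulrC (swap_sign _ _ _)) -[RHS]scalerA; congr (_ *: _).
have := @ne_letter j k; case: (left j) (left k) => [] [] /= ne.
- exact: osc_var_comm.
- by rewrite osc_var_der ne // mul0r scale0r subr0.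
- by rewrite osc_der_var ne // scale0r addr0.
- exact: osc_der_comm.
Qed.

Lemma oscQP j k : osc_Q j * osc_P k =
  (-1) ^+ (par j && par k) *: (osc_P k * osc_Q j) + (j == k)%:R *: 1.
Proof.
rewrite -/(swap_sign C (letter j) (letter k)) /osc_Q /osc_P.
rewrite -scalerAl -scalerAr scalerA mulrC -scalerA -(inj_eq letter_inj).
have := @ne_letter j k; rewrite /left_sign; case: (left j) (left k) => [] [] /= ne.
- rewrite osc_var_der scalerBr; congr (_ + _).
  rewrite scalerA -scaleNr; congr (_ *: _).
  case: eqVneq => [->|_]; last by rewrite mul0r mulr0 oppr0.
  by rewrite /swap_sign andbb mul1r mulNr opprK -expr2 sqrr_sign.
- by rewrite ne // osc_var_comm scale0r addr0.
- by rewrite ne // osc_der_comm scale0r addr0.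
- by rewrite opprK !scale1r osc_der_var.
Qed.

Lemma oscP_parity j : osc_parity (par j) (osc_P j).
Proof.
by rewrite /osc_P; case: ifP => _; [apply: osc_der_parity | apply: osc_var_parity].
Qed.

Lemma oscQ_parity j : osc_parity (par j) (osc_Q j).
Proof.
rewrite /osc_Q -[_ *: _]addr0; apply: osc_parityP; last exact: osc_parity0.
by case: ifP => _; [apply: osc_var_parity | apply: osc_der_parity].
Qed.

Lemma quad_parity b M : khomog par b M -> osc_parity b (quad osc_P osc_Q M).
Proof.
move=> hM; rewrite /quad; elim/big_rec: _ => [|x y _ yb]; first exact: osc_parity0.
have [->|nz] := eqVneq (M x.1 x.2) 0; first by rewrite scale0r add0r.
apply: osc_parityP => //; rewrite -(hM _ _ nz).
by apply: osc_parityM; [apply: oscP_parity | apply: oscQ_parity].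
Qed.

End LetterPairs.

(** * Adjoints of quadratic operators *)

Section LetterPairsAdjoint.
Variables (C : numClosedFieldType) (E O J : finType).
Variables (letter : J -> E + O) (left : pred J).
Local Notation P := (@osc_P C E O J letter left).
Local Notation Q := (@osc_Q C E O J letter left).
Local Notation eps := (@left_sign C E O J letter left).

Lemma adjoint0 : adjoint (0 : oscillator C E O) = 0.
Proof.
have [lin _ _] := @adjoint_anti C E O.
rewrite -[X in adjoint X](addNr (0 : oscillator C E O)) -scaleN1r lin.
by rewrite rmorphN1 scaleN1r addNr.
Qed.

Lemma adjointZ c (a : oscillator C E O) : adjoint (c *: a) = c^* *: adjoint a.
Proof.
have [lin _ _] := @adjoint_anti C E O.
by rewrite -[c *: a]addr0 lin adjoint0 addr0.
Qed.

Lemma conj_left_sign j : (eps j)^* = eps j.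
Proof. by rewrite /left_sign; case: ifP => _; rewrite ?rmorph_sign ?rmorphN1. Qed.

Lemma adjoint_oscP j : adjoint (P j) = - eps j *: Q j.
Proof.
rewrite /osc_Q scalerA mulrNN left_sign_sq scale1r /osc_P.
by case: ifP => _; rewrite ?adjoint_der ?adjoint_var.
Qed.

Lemma adjoint_oscQ j : adjoint (Q j) = - eps j *: P j.
Proof.
rewrite /osc_Q adjointZ rmorphN /= conj_left_sign /osc_P.
by case: ifP => _; rewrite ?adjoint_der ?adjoint_var.
Qed.

(** The adjoint of [P j * Q k] is [eps j * eps k] times [P k * Q j]: reversing the product while
    exchanging P and Q restores the order P Q, so no constant term appears. *)
Lemma adjoint_quad M : adjoint (quad P Q M) =
  quad P Q (fun j k => eps j * eps k * (M k j)^*).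
Proof.
have [lin anti _] := @adjoint_anti C E O.
rewrite /quad [RHS](reindex (fun x => (x.2, x.1))) /=; last first.
  by exists (fun x => (x.2, x.1)) => -[].
elim/big_rec2: _ => [|x b a _ <-].
  exact: adjoint0.
rewrite lin anti adjoint_oscP adjoint_oscQ; congr (_ + _).
by rewrite -scalerAl -scalerAr !scalerA -mulrA mulrNN mulrC.
Qed.

End LetterPairsAdjoint.

(** * The map Phi *)

Section GLIndices.
Variables (d m n p q : nat).
Local Notation N := ((p + q) + (m + n))%N.
Local Notation odd_ix := (@gl_index_odd m n p q).

Lemma gl_index_ind (P : 'I_N -> Prop) :
    (forall r, P (iy m n q r)) -> (forall s, P (izeta m n p s)) ->
    (forall i, P (ix n p q i)) -> (forall j, P (ieta m p q j)) ->
  forall A, P A.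
Proof.
move=> Py Pz Px Pe A; rewrite -(splitK A); case: split => [a|b] /=.
  by rewrite -(splitK a); case: split => [r|s] /=; [apply: Py | apply: Pz].
by rewrite -(splitK b); case: split => [i|j] /=; [apply: Px | apply: Pe].
Qed.

Definition gl_letter (x : 'I_N * 'I_d) : osc_even d m p + osc_odd d n q :=
  match split x.1 with
  | inl a => match split a with
             | inl r => inl (inr r, x.2)
             | inr s => inr (inr s, x.2)
             end
  | inr b => match split b with
             | inl i => inl (inl i, x.2)
             | inr j => inr (inl j, x.2)
             end
  end.

(** The blocks of y and zeta, where [osc_P] is a derivative. *)
Definition gl_left (x : 'I_N * 'I_d) : bool := (x.1 < p + q)%N.

Lemma split_lshiftE a b (i : 'I_a) : split (lshift b i) = inl i.
Proof. exact: (unsplitK (inl i)). Qed.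

Lemma split_rshiftE a b (i : 'I_b) : split (rshift a i) = inr i.
Proof. exact: (unsplitK (inr i)). Qed.

Lemma gl_letter_y r l : gl_letter (iy m n q r, l) = inl (inr r, l).
Proof. by rewrite /gl_letter /iy !split_lshiftE. Qed.

Lemma gl_letter_zeta s l : gl_letter (izeta m n p s, l) = inr (inr s, l).
Proof. by rewrite /gl_letter /izeta split_lshiftE split_rshiftE. Qed.

Lemma gl_letter_x i l : gl_letter (ix n p q i, l) = inl (inl i, l).
Proof. by rewrite /gl_letter /ix split_rshiftE split_lshiftE. Qed.

Lemma gl_letter_eta j l : gl_letter (ieta m p q j, l) = inr (inl j, l).
Proof. by rewrite /gl_letter /ieta !split_rshiftE. Qed.

Lemma gl_letter_inj : injective gl_letter.
Proof.
pose g (v : osc_even d m p + osc_odd d n q) : 'I_N * 'I_d :=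
  match v with
  | inl (inr r, l) => (iy m n q r, l)
  | inr (inr s, l) => (izeta m n p s, l)
  | inl (inl i, l) => (ix n p q i, l)
  | inr (inl j, l) => (ieta m p q j, l)
  end.
apply: (can_inj (g := g)) => -[A l]; elim/gl_index_ind: A => k.
- by rewrite gl_letter_y.
- by rewrite gl_letter_zeta.
- by rewrite gl_letter_x.
- by rewrite gl_letter_eta.
Qed.

Lemma gl_left_lshift (a : 'I_(p + q)) l : gl_left (lshift (m + n) a, l).
Proof. by rewrite /gl_left /= ltn_ord. Qed.

Lemma gl_left_rshift (b : 'I_(m + n)) l : gl_left (rshift (p + q) b, l) = false.
Proof. by rewrite /gl_left /= ltnNge leq_addr. Qed.

Lemma gl_letter_parity A l : is_odd (gl_letter (A, l)) = odd_ix A.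
Proof.
rewrite /gl_index_odd; elim/gl_index_ind: A => k.
- rewrite gl_letter_y /= [(p <= k)%N]leqNgt ltn_ord /= -addnA.
  by rewrite leqNgt ltn_addr ?ltn_ord.
- by rewrite gl_letter_zeta /= leq_addr ltn_add2l ltn_ord.
- rewrite gl_letter_x /= [X in _ || X]leqNgt ltn_add2l ltn_ord orbF.
  by rewrite [(_ < p + q)%N]ltnNge leq_addr andbF.
- by rewrite gl_letter_eta /= addnA leq_addr orbT.
Qed.

End GLIndices.

(** * The Lie superalgebra and its oscillator representation *)

Section GLEnveloping.
Variables (C : fieldType) (d m n p q : nat).
Local Notation N := ((p + q) + (m + n))%N.
Local Notation odd_ix := (@gl_index_odd m n p q).
Local Notation ggl := (ggl C d m n p q).
Local Notation gpar := (@ggl_parity C d m n p q).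
Local Notation gbr := (@ggl_bracket C d m n p q).
Implicit Types (X : 'M[C]_d) (Y : 'M[C]_N) (z w : ggl).

Lemma glpartP b Y : glpart b Y = Y <->
  forall A B, Y A B != 0 -> odd_ix A (+) odd_ix B = b.
Proof.
split=> [eY A B|h]; last first.
  apply/matrixP=> A B; rewrite mxE; case: eqVneq => // nb.
  by apply/esym/eqP/negPn/negP => /h/eqP; apply/negP.
by rewrite -eY mxE; case: (_ (+) _ =P b) => // _; rewrite eqxx.
Qed.

Lemma glpart_homog b c Y : glpart b Y = Y -> glpart c Y = if b == c then Y else 0.
Proof.
case: eqVneq => [-> //|bc] eY; apply/matrixP=> A B; rewrite -eY !mxE.
case: (odd_ix A (+) odd_ix B =P c) => // ->.
by rewrite eq_sym (negPf bc).
Qed.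

Lemma glbracket_homog b c Y Y' : glpart b Y = Y -> glpart c Y' = Y' ->
  glbracket Y Y' = Y *m Y' - (-1) ^+ (b && c) *: (Y' *m Y).
Proof.
move=> hY hY'; rewrite /glbracket (bigD1 b) //=.
rewrite [X in _ + X]big1 => [|b' nb]; last first.
  apply: big1 => c' _; rewrite (glpart_homog b' hY) eq_sym (negPf nb).
  by rewrite mul0mx mulmx0 scaler0 subrr.
rewrite addr0 (bigD1 c) //= big1 => [|c' nc]; last first.
  rewrite (glpart_homog c' hY') eq_sym (negPf nc).
  by rewrite mul0mx mulmx0 scaler0 subrr.
by rewrite addr0 hY hY'.
Qed.

Lemma glpart_mul b c Y Y' : glpart b Y = Y -> glpart c Y' = Y' ->
  glpart (b (+) c) (Y *m Y') = Y *m Y'.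
Proof.
move=> /glpartP hY /glpartP hY'; apply/glpartP=> A B; rewrite mxE => nz.
have [D nzD] : exists D, Y A D * Y' D B != 0.
  apply/existsP; apply: contraNT nz => /existsPn h; apply/eqP/big1 => D _.
  exact/eqP/negPn/h.
move: nzD; rewrite mulf_eq0 negb_or => /andP[/hY <- /hY' <-].
by rewrite addbA -[_ (+) _ (+) odd_ix D]addbA addbb addbF.
Qed.

Lemma glpart_linear b : linear (@glpart C m n p q b).
Proof.
move=> c Y Y'; apply/matrixP=> A B; rewrite !mxE; case: ifP => // _.
by rewrite mulr0 addr0.
Qed.

Lemma ggl_grading : grading gpar.
Proof.
have part0 b : glpart b (0 : 'M[C]_N) = 0.
  by apply/matrixP=> A B; rewrite !mxE if_same.
split=> [b|b c z w [z1 z2] [w1 w2]|z|z [_ z2] [z1 z2']].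
- by split.
- split; last by rewrite /= glpart_linear z2 w2.
  by move=> hb; rewrite /= z1 // w1 // scaler0 addr0.
- have idem b : glpart b (glpart b z.2) = glpart b z.2.
    by apply/matrixP=> A B; rewrite !mxE; case: ifP => // ->.
  exists (z.1, glpart false z.2), (0, glpart true z.2); split=> //.
  case: z idem => X Y _; congr pair; rewrite /= ?addr0 //.
  apply/matrixP=> A B; rewrite !mxE.
  by case: (_ (+) _); rewrite ?addr0 ?add0r.
- case: z z1 z2 z2' => X Y /= -> // z2 z2'; congr pair.
  by rewrite -z2' (glpart_homog true z2).
Qed.

Lemma ggl_bracket_parity b c z w :
  gpar b z -> gpar c w -> gpar (b (+) c) (gbr z w).
Proof.
move=> [z1 z2] [w1 w2]; split=> /=.
  case: b z1 z2 => [/(_ isT) ->|_] _; first by rewrite mul0mx mulmx0 subrr.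
  by move=> /w1 ->; rewrite mul0mx mulmx0 subrr.
rewrite (glbracket_homog z2 w2) addrC -scaleNr glpart_linear.
by rewrite (glpart_mul z2 w2) addbC (glpart_mul w2 z2).
Qed.

Lemma ggl_sum_delta z :
  z = \sum_a \sum_b z.1 a b *: ((delta_mx a b, 0) : ggl) +
      \sum_A \sum_B z.2 A B *: ((0, delta_mx A B) : ggl).
Proof.
have sum1 (I : finType) (F : I -> 'M[C]_d) :
    \sum_i ((F i, 0) : ggl) = (\sum_i F i, 0).
  elim/big_rec2: _ => // i x y _ ->; congr pair; exact: addr0.
have sum2 (I : finType) (F : I -> 'M[C]_N) :
    \sum_i ((0, F i) : ggl) = (0, \sum_i F i).
  elim/big_rec2: _ => // i x y _ ->; congr pair; exact: addr0.
have -> : \sum_a \sum_b z.1 a b *: ((delta_mx a b, 0) : ggl) = (z.1, 0).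
  rewrite [in RHS](matrix_sum_delta z.1) -sum1; apply: eq_bigr => a _.
  by rewrite -sum1; apply: eq_bigr => b _; congr pair; apply: scaler0.
have -> : \sum_A \sum_B z.2 A B *: ((0, delta_mx A B) : ggl) = (0, z.2).
  rewrite [in RHS](matrix_sum_delta z.2) -sum2; apply: eq_bigr => a _.
  by rewrite -sum2; apply: eq_bigr => b _; congr pair; apply: scaler0.
by case: z => X Y; congr pair; rewrite /= ?addr0 ?add0r.
Qed.

Lemma Ugl_superalgebra : (2 : C) != 0 -> superalgebra (@Ugl_parity C d m n p q).
Proof.
move=> two; apply: uea_superalgebra => //; first exact: ggl_grading.
exact: ggl_bracket_parity.
Qed.

Local Notation J := ('I_N * 'I_d)%type.
Local Notation letter := (@gl_letter d m n p q).
Local Notation left := (@gl_left d m n p q).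
Local Notation P := (@osc_P C _ _ J letter left).
Local Notation Q := (@osc_Q C _ _ J letter left).
Local Notation par := (fun x : J => is_odd (letter x)).

(* The matrix Y (x) 1 + 1 (x) X acting on C^(p+m|q+n) (x) C^d. *)
Definition kron z : J -> J -> C := fun x y =>
  (x.1 == y.1)%:R * z.1 x.2 y.2 + z.2 x.1 y.1 * (x.2 == y.2)%:R.

Lemma kron_linear c z w x y : kron (c *: z + w) x y = c * kron z x y + kron w x y.
Proof.
rewrite /kron /= !mxE mulrDr mulrDl !mulrA addrACA mulrDr !mulrA.
by rewrite (mulrC c (_ == _)%:R).
Qed.

Lemma kron_homog b z : gpar b z -> khomog par b (kron z).
Proof.
move=> [z1 /glpartP z2] [A k] [B l]; rewrite /kron /= !gl_letter_parity.
case: (eqVneq A B) => [->|AB].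
  case: b z1 z2 => [/(_ isT) ->|_] z2.
    by rewrite mxE mulr0 add0r mulf_eq0 negb_or => /andP[/z2].
  by rewrite addbb.
by rewrite mul0r add0r mulf_eq0 negb_or => /andP[/z2].
Qed.

Lemma sum_deltal (I : finType) (i : I) (F : I -> C) :
  \sum_j (i == j)%:R * F j = F i.
Proof.
rewrite (bigD1 i) //= eqxx mul1r big1 ?addr0 // => j /negPf ji.
by rewrite eq_sym ji mul0r.
Qed.

Lemma sum_deltar (I : finType) (i : I) (F : I -> C) :
  \sum_j F j * (j == i)%:R = F i.
Proof.
by rewrite -[RHS]sum_deltal; apply: eq_bigr => j _; rewrite mulrC eq_sym.
Qed.

(** The last summand collects the two mixed products of a matrix on one tensor factor with a matrix
    on the other. It is symmetric in [z] and [w], which makes it disappear from the superbracket. *)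
Lemma kron_mul z w x y : kmul (kron z) (kron w) x y =
  kron (z.1 *m w.1, z.2 *m w.2) x y +
  (z.1 x.2 y.2 * w.2 x.1 y.1 + z.2 x.1 y.1 * w.1 x.2 y.2).
Proof.
case: x y => [A k] [B l]; rewrite /kmul /kron /= !mxE.
rewrite -(pair_bigA _ (fun D h => ((A == D)%:R * z.1 k h + z.2 A D * (k == h)%:R) *
   ((D == B)%:R * w.1 h l + w.2 D B * (h == l)%:R))) /=.
(* The four groups are the product in the [gl_d] factor, the two mixed products, and the product in
   the other factor. *)
transitivity (\sum_D ((A == D)%:R * (\sum_h z.1 k h * ((D == B)%:R * w.1 h l))
   + (A == D)%:R * (\sum_h z.1 k h * w.2 D B * (h == l)%:R)
   + ((\sum_h (k == h)%:R * (z.2 A D * w.1 h l)) * (D == B)%:R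
   + (\sum_h (k == h)%:R * (z.2 A D * w.2 D B * (h == l)%:R))))).
  apply: eq_bigr => D _; rewrite !mulr_sumr mulr_suml -!big_split.
  apply: eq_bigr => h _ /=; rewrite mulrDl !mulrDr !mulrA.
  congr (_ + _ + (_ + _)).
    by rewrite -!mulrA [w.1 h l * _]mulrC !mulrA (mulrC (k == h)%:R).
  by rewrite -!mulrA !(mulrCA (k == h)%:R).
rewrite !big_split /= !sum_deltal sum_deltar.
under [X in _ + (X + _)]eq_bigr do rewrite sum_deltal.
under [X in _ + (_ + X)]eq_bigr do rewrite sum_deltal.
rewrite sum_deltar.
under eq_bigr do rewrite mulrCA.
rewrite -mulr_sumr -mulr_suml -!addrA; congr (_ + _).
by rewrite [RHS]addrC -addrA.
Qed.

(** The scalar correction in [Phi_gen] is a multiple of the trace, so it vanishes on brackets. *)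
Lemma mxtrace_comm X X' : \tr (X *m X' - X' *m X) = 0.
Proof. by rewrite raddfB /= mxtrace_mulC subrr. Qed.

(* The scalar restores normal order: dy y = y dy + 1, dzeta zeta = 1 - zeta dzeta. *)
Definition Phi_gen z : Osc C d m n p q :=
  quad P Q (kron z) + ((p%:R - q%:R) * \tr z.1) *: 1.

Lemma Phi_gen_linear : linear Phi_gen.
Proof.
move=> c z w; rewrite /Phi_gen scalerDr addrACA -quad_linear; congr (_ + _).
  by apply: eq_bigr => x _; rewrite kron_linear.
by rewrite scalerA -scalerDl /= linearP mulrDr mulrCA.
Qed.

Lemma Phi_gen_parity b z : gpar b z -> @Osc_parity C d m n p q b (Phi_gen z).
Proof.
move=> zb; have zq := @quad_parity C _ _ J letter left b _ (kron_homog zb).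
have [z1 _] := zb.
rewrite /Phi_gen; case: b z1 {zb} zq => [/(_ isT) ->|_] zq.
  by rewrite mxtrace0 mulr0 scale0r addr0.
by rewrite addrC; apply: osc_parityP => //; apply: osc_parity1.
Qed.

Lemma Phi_gen_bracket b c z w : gpar b z -> gpar c w ->
  Phi_gen z * Phi_gen w - (-1) ^+ (b && c) *: (Phi_gen w * Phi_gen z) =
  Phi_gen (gbr z w).
Proof.
move=> zb wc; rewrite /Phi_gen /= mxtrace_comm mulr0 scale0r addr0.
have -> : quad P Q (kron (gbr z w)) =
    quad P Q (kron z) * quad P Q (kron w) -
    (-1) ^+ (b && c) *: (quad P Q (kron w) * quad P Q (kron z)).
  rewrite (quad_bracket (@oscPP _ _ _ _ _ left (@gl_letter_inj d m n p q))
    (@oscQQ _ _ _ _ _ left (@gl_letter_inj d m n p q))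
    (@oscQP _ _ _ _ _ left (@gl_letter_inj d m n p q))
    (kron_homog zb) (kron_homog wc)).
  apply: eq_bigr => x _; congr (_ *: _); rewrite !kron_mul.
  have [[z1 z2] [w1 w2]] := (zb, wc).
  have mxB (k l : nat) (M M' : 'M[C]_(k, l)) i j : (M - M') i j = M i j - M' i j.
    by rewrite !mxE.
  have mxZ (k l : nat) e (M : 'M[C]_(k, l)) i j : (e *: M) i j = e * M i j.
    by rewrite mxE.
  rewrite /kron /= (glbracket_homog z2 w2) !mxB mxZ.
  (* For two odd elements the [gl_d] components vanish, and with them the mixed terms; otherwise the
     bracket is an ordinary commutator and the symmetric mixed terms cancel. *)
  have [bc|bc] := boolP (b && c).
    case/andP: bc => bt ct; rewrite (z1 bt) (w1 ct).
    rewrite !mul0mx !mxE expr1; ring.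
  rewrite expr0 mul1r; ring.
set k := (_ * \tr z.1); set k' := (_ * \tr w.1).
rewrite !mulrDl !mulrDr -!scalerAl -!scalerAr !mul1r !mulr1.
(* The same alternative for the scalars: they are 0 when both elements are odd, and central in a
   commutator otherwise. *)
have [bc|_] := boolP (b && c).
  have [[z1 _] [w1 _]] := (zb, wc); case/andP: bc => bt ct.
  rewrite /k /k' (z1 bt) (w1 ct) !mxtrace0 !mulr0 !scale0r ?scaler0 !addr0.
  by [].
rewrite !scale1r [(_ + k' *: _) + _]addrACA (scalerA k) (scalerA k') (mulrC k').
by rewrite opprD [LHS]addrACA subrr addr0 opprD [LHS]addrACA subrr addr0.
Qed.

Lemma Phi_exists : exists Phi : Ugl C d m n p q -> Osc C d m n p q,
  superalgebra_hom (@Ugl_parity C d m n p q) (@Osc_parity C d m n p q) Phi /\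
  forall z, Phi (uea_gen gpar gbr z) = Phi_gen z.
Proof.
have [|||F [Flin F1 FM Fgen]] := @uea_lift C ggl gpar gbr
  (Osc C d m n p q) (in_alg (Osc C d m n p q)) Phi_gen.
- by move=> c x; rewrite /= -scalerAl -scalerAr mul1r mulr1.
- by move=> c x y; rewrite Phi_gen_linear /= -scalerAl mul1r.
- by move=> b c x y bx cy; rewrite -(Phi_gen_bracket bx cy) /= -scalerAl mul1r.
exists F; split=> //; apply: uea_parity_hom.
- exact: osc_superalgebra.
- by move=> c x y; rewrite Flin /= -scalerAl mul1r.
- by split.
- by move=> b z zb; rewrite Fgen; apply: Phi_gen_parity.
Qed.

Lemma sum_boolZ (V : lmodType C) (I : finType) (b : pred I) (F : I -> V) :
  \sum_i (b i)%:R *: F i = \sum_(i | b i) F i.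
Proof.
rewrite [RHS]big_mkcond; apply: eq_bigr => i _.
by case: (b i); rewrite ?scale1r ?scale0r.
Qed.

Lemma Phi_gen_E D D' :
  Phi_gen (0, delta_mx D D') = \sum_l P (D, l) * Q (D', l).
Proof.
rewrite /Phi_gen mxtrace0 mulr0 scale0r addr0 /quad.
pose b (x : J * J) := [&& x.1.1 == D, x.2.1 == D' & x.1.2 == x.2.2].
transitivity (\sum_x (b x)%:R *: (P x.1 * Q x.2)).
  apply: eq_bigr => x _; rewrite /kron /= !mxE mulr0 add0r /b.
  by rewrite -natrM mulnb andbA.
rewrite sum_boolZ (reindex_onto (fun l => ((D, l), (D', l))) (fun x => x.1.2)) /=.
  by apply: eq_bigl => l; rewrite /b /= !eqxx.
by move=> [[D1 l] [D2 l']] /and3P[/= /eqP-> /eqP-> /eqP->].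
Qed.

Lemma Phi_gen_e a b : Phi_gen (delta_mx a b, 0) =
  \sum_D P (D, a) * Q (D, b) + ((p%:R - q%:R) * (a == b)%:R) *: 1.
Proof.
rewrite /Phi_gen /=; congr (_ + (_ * _) *: _); last first.
  rewrite /mxtrace (bigD1 a) //= big1 ?addr0 => [|c /negPf ca]; last first.
    by rewrite mxE ca.
  by rewrite mxE eqxx.
pose e (x : J * J) := [&& x.1.1 == x.2.1, x.1.2 == a & x.2.2 == b].
transitivity (\sum_x (e x)%:R *: (P x.1 * Q x.2)).
  apply: eq_bigr => x _; rewrite /kron /= !mxE mul0r addr0 /e.
  by rewrite -natrM mulnb.
rewrite sum_boolZ (reindex_onto (fun D => ((D, a), (D, b))) (fun x => x.1.1)) /=.
  by apply: eq_bigl => l; rewrite /e /= !eqxx.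
by move=> [[D1 l] [D2 l']] /and3P[/= /eqP-> /eqP-> /eqP->].
Qed.

Lemma oscP_y r l : P (iy m n q r, l) = dy C m n q r l.
Proof. by rewrite /osc_P gl_left_lshift gl_letter_y. Qed.

Lemma oscP_zeta s l : P (izeta m n p s, l) = dzeta C m n p s l.
Proof. by rewrite /osc_P gl_left_lshift gl_letter_zeta. Qed.

Lemma oscP_x i l : P (ix n p q i, l) = xvar C n p q i l.
Proof. by rewrite /osc_P gl_left_rshift gl_letter_x. Qed.

Lemma oscP_eta j l : P (ieta m p q j, l) = etavar C m p q j l.
Proof. by rewrite /osc_P gl_left_rshift gl_letter_eta. Qed.

Lemma oscQ_y r l : Q (iy m n q r, l) = - yvar C m n q r l.
Proof.
by rewrite /osc_Q /left_sign gl_left_lshift gl_letter_y expr0 scaleN1r.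
Qed.

Lemma oscQ_zeta s l : Q (izeta m n p s, l) = zetavar C m n p s l.
Proof.
by rewrite /osc_Q /left_sign gl_left_lshift gl_letter_zeta expr1 opprK scale1r.
Qed.

Lemma oscQ_x i l : Q (ix n p q i, l) = dx C n p q i l.
Proof.
by rewrite /osc_Q /left_sign gl_left_rshift gl_letter_x opprK scale1r.
Qed.

Lemma oscQ_eta j l : Q (ieta m p q j, l) = deta C m p q j l.
Proof.
by rewrite /osc_Q /left_sign gl_left_rshift gl_letter_eta opprK scale1r.
Qed.

Lemma sum_gl_index (V : zmodType) (F : 'I_N -> V) : \sum_D F D =
  \sum_i F (ix n p q i) + \sum_j F (ieta m p q j)
  + \sum_r F (iy m n q r) + \sum_s F (izeta m n p s).
Proof.
by rewrite big_split_ord /= addrC !big_split_ord /= addrA.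
Qed.

(** Moving the derivative to the right contributes [- (a == b)%:R] for each of the [p] letters y and
    [(a == b)%:R] for each of the [q] letters zeta; the sum is cancelled by the scalar in
    [Phi_gen]. *)
Lemma Phi_gen_e_normal a b : Phi_gen (delta_mx a b, 0) =
  \sum_k xvar C n p q k a * dx C n p q k b
  + \sum_k etavar C m p q k a * deta C m p q k b
  - \sum_k yvar C m n q k b * dy C m n q k a
  - \sum_k zetavar C m n p k b * dzeta C m n p k a.
Proof.
rewrite Phi_gen_e sum_gl_index -!addrA; congr (_ + _).
  by apply: eq_bigr => k _; rewrite oscP_x oscQ_x.
congr (_ + _); first by apply: eq_bigr => k _; rewrite oscP_eta oscQ_eta.
have sumc k (c : C) : (k%:R * c) *: (1 : Osc C d m n p q) = \sum_(i < k) c *: 1.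
  by rewrite sumr_const card_ord -scalerA scaler_nat.
have -> : \sum_r P (iy m n q r, a) * Q (iy m n q r, b) =
    - (\sum_k yvar C m n q k b * dy C m n q k a) - (p%:R * (a == b)%:R) *: 1.
  rewrite sumc -opprD -big_split -sumrN; apply: eq_bigr => k _ /=.
  rewrite oscP_y oscQ_y mulrN osc_der_var scale1r.
  by rewrite (inj_eq (@inl_inj _ _)) xpair_eqE eqxx.
have -> : \sum_s P (izeta m n p s, a) * Q (izeta m n p s, b) =
    - (\sum_k zetavar C m n p k b * dzeta C m n p k a) + (q%:R * (a == b)%:R) *: 1.
  rewrite sumc -sumrN -big_split; apply: eq_bigr => k _ /=.
  rewrite oscP_zeta oscQ_zeta osc_der_var scaleN1r.
  by rewrite (inj_eq (@inr_inj _ _)) xpair_eqE eqxx.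
rewrite mulrBl scalerBl -addrA; congr (_ + _).
by rewrite addrC -addrA [_ - _ - _]addrAC subrr add0r addrK.
Qed.

Lemma Phi_is_Phi (Phi : Ugl C d m n p q -> Osc C d m n p q) :
    superalgebra_hom (@Ugl_parity C d m n p q) (@Osc_parity C d m n p q) Phi ->
    (forall z, Phi (uea_gen gpar gbr z) = Phi_gen z) ->
  is_Phi Phi.
Proof.
move=> hPhi gPhi; split=> // *; rewrite gPhi ?Phi_gen_e_normal //.
all: rewrite Phi_gen_E -?sumrN; apply: eq_bigr => l _.
all: rewrite ?(oscP_y, oscP_zeta, oscP_x, oscP_eta).
all: by rewrite ?(oscQ_y, oscQ_zeta, oscQ_x, oscQ_eta) ?mulrN.
Qed.

(** The prescribed values of [Phi] and [sigma] concern elementary matrices only; this induction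
    makes them determine the maps. *)
Lemma Ugl_ind (R : Ugl C d m n p q -> Prop) :
    (forall a b, R (egl C m n p q a b)) -> (forall D D', R (Egl C d D D')) ->
    R 1 -> (forall c u v, R u -> R v -> R (c *: u + v)) ->
    (forall u v, R u -> R v -> R (u * v)) ->
  forall u, R u.
Proof.
move=> Re RE R1 Rlin Rmul; apply: uea_generated_ind => // z.
have R0 : R 0 by rewrite -(addNr 1) -scaleN1r; apply: Rlin.
have RD u v : R u -> R v -> R (u + v).
  by move=> Ru Rv; rewrite -[u]scale1r; apply: Rlin.
have RZ c u : R u -> R (c *: u).
  by move=> Ru; rewrite -[c *: u]addr0; apply: Rlin.
have genD x y : uea_gen gpar gbr (x + y) = uea_gen gpar gbr x + uea_gen gpar gbr y.
  by rewrite -[x]scale1r uea_gen_linear !scale1r.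
have Rsum (I : finType) (F : I -> ggl) : (forall i, R (uea_gen gpar gbr (F i))) ->
    R (uea_gen gpar gbr (\sum_i F i)).
  move=> RF; elim/big_rec: _ => [|i x _ Rx]; first by rewrite uea_gen0.
  by rewrite genD; apply: RD.
rewrite [z]ggl_sum_delta genD; apply: RD.
  by do 2!apply: (Rsum _ _) => ?; rewrite uea_genZ; apply/RZ/Re.
by do 2!apply: (Rsum _ _) => ?; rewrite uea_genZ; apply/RZ/RE.
Qed.

Lemma is_Phi_unique (Phi Phi' : Ugl C d m n p q -> Osc C d m n p q) :
  is_Phi Phi -> is_Phi Phi' -> Phi = Phi'.
Proof.
move=> [[lin [one mul] _] e1 yy zz zy yz xx ee xe ex yx ye zx ze xy xz ey ez].
move=> [[lin' [one' mul'] _] e1' yy' zz' zy' yz' xx' ee' xe' ex'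
  yx' ye' zx' ze' xy' xz' ey' ez'].
apply: funext; elim/Ugl_ind => [a b|D D'||c u v hu hv|u v hu hv].
- by rewrite e1 e1'.
- elim/gl_index_ind: D => ?; elim/gl_index_ind: D' => ?.
  + by rewrite yy yy'.
  + by rewrite yz yz'.
  + by rewrite yx yx'.
  + by rewrite ye ye'.
  + by rewrite zy zy'.
  + by rewrite zz zz'.
  + by rewrite zx zx'.
  + by rewrite ze ze'.
  + by rewrite xy xy'.
  + by rewrite xz xz'.
  + by rewrite xx xx'.
  + by rewrite xe xe'.
  + by rewrite ey ey'.
  + by rewrite ez ez'.
  + by rewrite ex ex'.
  + by rewrite ee ee'.
- by rewrite one one'.
- by rewrite lin lin' hu hv.
- by rewrite mul mul' hu hv.
Qed.

End GLEnveloping.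

(** * The star structure sigma *)

Section GLStarStructure.
Variables (C : numClosedFieldType) (d m n p q : nat).
Local Notation N := ((p + q) + (m + n))%N.
Local Notation ggl := (ggl C d m n p q).
Local Notation gpar := (@ggl_parity C d m n p q).
Local Notation gbr := (@ggl_bracket C d m n p q).
Local Notation U := (Ugl C d m n p q).
Local Notation gen := (uea_gen gpar gbr).
Local Notation letter := (@gl_letter d m n p q).
Local Notation left := (@gl_left d m n p q).
Implicit Types (X : 'M[C]_d) (Y : 'M[C]_N) (z w : ggl).

(** One sign per index: the factors in all four matrix clauses of [is_sigma] are products
    [gl_sign D * gl_sign D']. *)
Definition gl_sign (D : 'I_N) : C :=
  match split D with inl a => sgi C a | inr _ => -1 end.

(** The link between the two star structures: the signs of [sigma] are those that occur in the
    adjoints of the letters. *)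
Lemma gl_signE D l : left_sign C letter left (D, l) = gl_sign D.
Proof.
rewrite /left_sign /gl_sign gl_letter_parity; case: (split_ordP D) => [a|b] ->.
  rewrite gl_left_lshift /sgi /gl_index_odd /=.
  by rewrite ltn_ord andbT [(_ + m <= _)%N]leqNgt ltn_addr ?ltn_ord ?orbF.
by rewrite gl_left_rshift.
Qed.

Lemma gl_sign_sq D : gl_sign D * gl_sign D = 1.
Proof.
rewrite /gl_sign; case: split => [a|_]; last by rewrite mulrNN mulr1.
by rewrite /sgi -expr2 sqrr_sign.
Qed.

Lemma conj_gl_sign D : (gl_sign D)^* = gl_sign D.
Proof.
by rewrite /gl_sign; case: split => [a|_]; rewrite ?rmorph_sign ?rmorphN1.
Qed.

Definition star_d X : 'M[C]_d := \matrix_(a, b) (X b a)^*.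
Definition star_N Y : 'M[C]_N :=
  \matrix_(D, D') (gl_sign D * gl_sign D' * (Y D' D)^*).
Definition sigma_gl z : ggl := (star_d z.1, star_N z.2).

Lemma sigma_gl_antilinear : antilinear sigma_gl.
Proof.
move=> c [X Y] [X' Y']; congr pair; apply/matrixP=> i j; rewrite !mxE /=.
  by rewrite rmorphD rmorphM.
by rewrite rmorphD rmorphM mulrDr mulrCA.
Qed.

Lemma sigma_glK : involutive sigma_gl.
Proof.
move=> [X Y]; congr pair; apply/matrixP=> i j; rewrite !mxE /= ?conjCK //.
rewrite !rmorphM /= conjCK !conj_gl_sign !mulrA.
rewrite -!mulrA !(mulrCA (gl_sign j)) !(mulrA (gl_sign j)).
by rewrite gl_sign_sq mul1r mulrA gl_sign_sq mul1r.
Qed.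

Lemma star_d_mul X X' : star_d (X *m X') = star_d X' *m star_d X.
Proof.
apply/matrixP=> a b; rewrite !mxE rmorph_sum; apply: eq_bigr => c _.
by rewrite rmorphM !mxE mulrC.
Qed.

Lemma star_N_mul Y Y' : star_N (Y *m Y') = star_N Y' *m star_N Y.
Proof.
apply/matrixP=> a b; rewrite !mxE rmorph_sum mulr_sumr; apply: eq_bigr => c _.
rewrite rmorphM !mxE /= -[LHS]mulr1 -(gl_sign_sq c); ring.
Qed.

Lemma sigma_gl_parity b z : gpar b z -> gpar b (sigma_gl z).
Proof.
move=> [z1 /glpartP z2]; split=> [/z1 ez|].
  by rewrite /sigma_gl /= ez; apply/matrixP=> i j; rewrite !mxE rmorph0.
apply/glpartP=> D D'; rewrite mxE => nz; rewrite addbC; apply: z2.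
by apply: contraNneq nz => ->; rewrite rmorph0 mulr0.
Qed.

Lemma star_d_linear c X X' : star_d (c *: X + X') = c^* *: star_d X + star_d X'.
Proof. by apply/matrixP=> i j; rewrite !mxE rmorphD rmorphM. Qed.

Lemma star_N_linear c Y Y' : star_N (c *: Y + Y') = c^* *: star_N Y + star_N Y'.
Proof.
by apply/matrixP=> i j; rewrite !mxE rmorphD rmorphM mulrDr mulrCA.
Qed.

(** The arguments are reversed and no sign appears, which is the compatibility required for lifting
    [sigma_gl] to the converse ring. *)
Lemma sigma_gl_bracket b c z w : gpar b z -> gpar c w ->
  sigma_gl (gbr z w) = gbr (sigma_gl w) (sigma_gl z).
Proof.
move=> zb wc; have [[_ z2] [_ w2]] := (zb, wc).
have [[_ sz2] [_ sw2]] := (sigma_gl_parity zb, sigma_gl_parity wc).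
rewrite /sigma_gl /ggl_bracket /=; congr pair.
  by rewrite addrC -scaleN1r star_d_linear rmorphN1 scaleN1r !star_d_mul addrC.
rewrite (glbracket_homog z2 w2) (glbracket_homog sw2 sz2) andbC.
rewrite addrC -scaleNr star_N_linear rmorphN rmorph_sign scaleNr !star_N_mul.
by rewrite addrC.
Qed.

Definition conj_scal (c : C) : U^c := c^* *: (1 : U).

Fact conj_scal_zmod_morphism : zmod_morphism conj_scal.
Proof. by move=> a b; rewrite /conj_scal rmorphB scalerBl. Qed.

Fact conj_scal_monoid_morphism : monoid_morphism conj_scal.
Proof.
split=> [|a b]; first by rewrite /conj_scal rmorph1 scale1r.
rewrite /conj_scal -[X in _ = X]/((b^* *: (1 : U)) * (a^* *: (1 : U))).
by rewrite -scalerAl mul1r scalerA rmorphM mulrC.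
Qed.

HB.instance Definition _ :=
  GRing.isZmodMorphism.Build C U^c conj_scal conj_scal_zmod_morphism.
HB.instance Definition _ :=
  GRing.isMonoidMorphism.Build C U^c conj_scal conj_scal_monoid_morphism.

Lemma sigma_exists : exists sigma : U -> U,
  anti_involution sigma /\ forall z, sigma (gen z) = gen (sigma_gl z).
Proof.
have [|||F [Flin F1 FM Fgen]] := @uea_lift C ggl gpar gbr U^c conj_scal
  (fun z => gen (sigma_gl z)).
- move=> c x.
  (* A product in [U^c] is the product of [U] in reverse order; the conversion states the identity
     in [U]. *)
  rewrite -[LHS]/((x : U) * (c^* *: (1 : U))) -[RHS]/((c^* *: (1 : U)) * (x : U)).
  by rewrite -scalerAl -scalerAr mul1r mulr1.
- move=> c x y; rewrite sigma_gl_antilinear uea_gen_linear; congr (_ + _).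
  by rewrite -[RHS]/(_ * (c^* *: (1 : U)) : U) -scalerAr mulr1.
- move=> b c x y xb yc; rewrite (sigma_gl_bracket xb yc).
  rewrite -(uea_gen_bracket gbr (sigma_gl_parity yc) (sigma_gl_parity xb)).
  rewrite -[LHS]/(gen (sigma_gl y) * gen (sigma_gl x) -
    gen (sigma_gl x) * gen (sigma_gl y) * (((-1) ^+ (b && c))^* *: (1 : U)) : U).
  by rewrite -scalerAr mulr1 rmorph_sign andbC.
have {}Flin (c : C) (u v : U) : F (c *: u + v) = c^* *: (F u : U) + (F v : U).
  rewrite Flin -[LHS]/((F u : U) * (c^* *: (1 : U)) + (F v : U) : U).
  by rewrite -scalerAr mulr1.
exists F; split=> //; split=> [//|u v|]; first exact: FM.
elim/uea_generated_ind => [z||c u v hu hv|u v hu hv].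
- by rewrite !Fgen sigma_glK.
- by rewrite !F1.
- by rewrite !Flin conjCK hu hv.
- by rewrite !FM -[LHS]/((F (F u) : U) * (F (F v) : U)) hu hv.
Qed.

Lemma sigma_gl_e a b : sigma_gl (delta_mx a b, 0) = (delta_mx b a, 0).
Proof.
congr pair; apply/matrixP=> i j; rewrite !mxE /= ?rmorph0 ?mulr0 //.
by rewrite rmorph_nat andbC.
Qed.

Lemma sigma_gl_E D D' :
  sigma_gl (0, delta_mx D D') = (gl_sign D * gl_sign D') *: ((0, delta_mx D' D) : ggl).
Proof.
congr pair; apply/matrixP=> i j; rewrite !mxE /= ?rmorph0 ?mulr0 //.
rewrite rmorph_nat andbC; case: (eqVneq i D') => [->|_]; last by rewrite !mulr0.
by case: (eqVneq j D) => [->|_]; rewrite ?mulr0 // mulrC [gl_sign D' * _]mulrC mulrC.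
Qed.

Lemma gl_sign_lshift a : gl_sign (lshift (m + n) a) = sgi C a.
Proof. by rewrite /gl_sign split_lshiftE. Qed.

Lemma gl_sign_rshift b : gl_sign (rshift (p + q) b) = -1.
Proof. by rewrite /gl_sign split_rshiftE. Qed.

Lemma sigma_is_sigma (sigma : U -> U) : anti_involution sigma ->
  (forall z, sigma (gen z) = gen (sigma_gl z)) -> is_sigma sigma.
Proof.
move=> anti gsigma; split=> // *; rewrite gsigma ?sigma_gl_e //;
  by rewrite sigma_gl_E uea_genZ !(gl_sign_lshift, gl_sign_rshift)
    ?mulrN1 ?mulN1r ?opprK ?scale1r.
Qed.

Lemma is_sigma_unique (sigma sigma' : U -> U) :
  is_sigma sigma -> is_sigma sigma' -> sigma = sigma'.
Proof.
move=> [anti ll rr lr rl e] [anti' ll' rr' lr' rl' e'].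
apply: funext; elim/Ugl_ind => [a b|D D'||c u v hu hv|u v hu hv].
- by rewrite e e'.
- case: (split_ordP D) => ? ->; case: (split_ordP D') => ? ->.
  + by rewrite ll ll'.
  + by rewrite lr lr'.
  + by rewrite rl rl'.
  + by rewrite rr rr'.
- by rewrite !anti_involution1.
- by case: anti anti' => [lin _ _] [lin' _ _]; rewrite lin lin' hu hv.
- by case: anti anti' => [_ mul _] [_ mul' _]; rewrite mul mul' hu hv.
Qed.

(** The sign of a pair depends on its first index alone. On the [gl_d] part the two first indices
    agree and the signs square to 1, leaving the plain conjugate transpose. *)
Lemma kron_sigma z x y : kron (sigma_gl z) x y =
  left_sign C letter left x * left_sign C letter left y * (kron z y x)^*.
Proof.
case: x y => [D k] [D' l]; rewrite !gl_signE.
rewrite /kron /= !mxE rmorphD !rmorphM !rmorph_nat mulrDr; congr (_ + _).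
  rewrite eq_sym mulrA; case: eqVneq => [->|_]; last by rewrite mulr0 !mul0r.
  by rewrite gl_sign_sq mulr1.
by rewrite eq_sym mulrA.
Qed.

Lemma mxtrace_star_d X : \tr (star_d X) = (\tr X)^*.
Proof. by rewrite /mxtrace rmorph_sum; apply: eq_bigr => i _; rewrite mxE. Qed.

(** Besides the quadratic part, the scalar correction is respected because [p - q] is real. *)
Lemma Phi_gen_sigma z : Phi_gen (sigma_gl z) = adjoint (Phi_gen z).
Proof.
have aanti := @adjoint_anti C (osc_even d m p) (osc_odd d n q).
have a1 := anti_involution1 aanti; have [lin _ _] := aanti.
rewrite /Phi_gen [in RHS]addrC lin a1 adjoint_quad rmorphM rmorphB !rmorph_nat.
rewrite mxtrace_star_d addrC; congr (_ + _).
by apply: eq_bigr => x _; rewrite kron_sigma.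
Qed.

Lemma Phi_star (Phi : U -> Osc C d m n p q) (sigma : U -> U) :
    linear Phi -> monoid_morphism Phi -> (forall z, Phi (gen z) = Phi_gen z) ->
    anti_involution sigma -> (forall z, sigma (gen z) = gen (sigma_gl z)) ->
  forall u, Phi (sigma u) = adjoint (Phi u).
Proof.
move=> Plin [P1 PM] Pgen santi sgen.
have aanti := @adjoint_anti C (osc_even d m p) (osc_odd d n q).
elim/uea_generated_ind => [z||c u v hu hv|u v hu hv].
- by rewrite sgen !Pgen Phi_gen_sigma.
- by rewrite (anti_involution1 santi) P1 (anti_involution1 aanti).
- by case: santi aanti => [slin _ _] [alin _ _]; rewrite slin !Plin alin hu hv.
- by case: santi aanti => [_ sM _] [_ aM _]; rewrite sM !PM aM hu hv.
Qed.

Lemma is_omega_adjoint : is_omega (@adjoint C (osc_even d m p) (osc_odd d n q)).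
Proof.
by split; [exact: adjoint_anti | exact: adjoint_var | exact: adjoint_der].
Qed.

End GLStarStructure.

(** * Compatibility of the star structures and unitarity *)

Theorem theorem3p2 (R : realType) (d m n p q : nat) (hd : (1 <= d)%N) :
  exists (Phi : Ugl R[i] d m n p q -> Osc R[i] d m n p q)
         (sigma : Ugl R[i] d m n p q -> Ugl R[i] d m n p q)
         (omega : Osc R[i] d m n p q -> Osc R[i] d m n p q)
         (form : hermitian_form (Spoly R[i] d m n p q)),
    [/\ unique (@is_Phi R[i] d m n p q) Phi,
        unique (@is_sigma R[i] d m n p q) sigma,
        unique (@is_omega R[i] d m n p q) omega
      & is_osc_form omega form /\
        forall form', is_osc_form omega form' -> form' =2 form] /\
    [/\ star_superalgebra_hom (@Ugl_parity R[i] d m n p q) sigma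
          (@Osc_parity R[i] d m n p q) omega Phi
      & unitarizable_module (@Ugl_parity R[i] d m n p q) sigma
          (@Spoly_parity R[i] d m n p q)
          (fun u v => Osc_act (Phi u) v) form].
Proof.
have [Phi [PhiH Phig]] := Phi_exists R[i] d m n p q.
have [sigma [santi sg]] := sigma_exists R[i] d m n p q.
have [Plin PM Ppar] := PhiH; have [P1 PMul] := PM.
have two : (2 : R[i]) != 0 by rewrite pnatr_eq0.
have Usuper := @Ugl_superalgebra R[i] d m n p q two.
have star := Phi_star Plin PM Phig santi sg.
pose form : hermitian_form (Spoly R[i] d m n p q) :=
  @sform R[i] (osc_even d m p) (osc_odd d n q).
exists Phi, sigma, (@adjoint R[i] _ _), form; split; split.
- by split; [exact: Phi_is_Phi | move=> Phi'; apply/is_Phi_unique/Phi_is_Phi].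
- by split; [exact: sigma_is_sigma | move=> s'; apply/is_sigma_unique/sigma_is_sigma].
- split; first exact: is_omega_adjoint.
  move=> w [wanti wvar wder]; apply: osc_anti_involution_unique => // [|v|v].
  + exact: adjoint_anti.
  + by rewrite adjoint_var wvar.
  + by rewrite adjoint_der wder.
- split; first by split; [move=> a f g; exact: adjointP | exact: sform11].
  move=> form' [contra form11]; apply: sform_unique => // v f g.
(* Since the adjoint of a variable is its derivative, contravariance for the operator [osc_var] is
   the required exchange rule. *)
rewrite -osc_varE -osc_derE -adjoint_var. exact: (contra (osc_var _ v) f g).
- split=> //.
  by split; [exact: osc_superalgebra | exact: adjoint_anti].
- split=> [//||u f g|f]; last 2 first.
  (* [Phi] turns [sigma] into the adjoint, so contravariance over the enveloping algebra is the
     defining property of the adjoint of [Phi u]. *)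
  + by rewrite star; apply: adjointP.
  + exact: sform_gt0.
  split=> [//||||b c u f /Ppar]; last exact.
  + exact: superpoly_grading.
  + split=> [a c f g|f c a b]; first exact: linearP.
    by rewrite /Osc_act Plin.
  + by split=> [f|a b f]; rewrite /Osc_act ?P1 ?PMul.
Qed.
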